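(* Let $X$ be a paracompact (Tychonoff) space. The following are equivalent: (a) $X$ is a finite $C$-space; (b) whenever $Y$ is a Banach space, $\phi\colon X\to\mathcal F_c(Y)$ is a lower semi-continuous map, and $\{\psi_n\}_{n\in\mathbb N}$ is a decreasing $Z$-sequence for $\phi$ consisting of maps $\psi_n\colon X\to\mathcal F(Y)$ with closed graph, there exist $m$ and a continuous selection for $\phi$ avoiding $\psi_m$, i.e. a continuous $f\colon X\to Y$ with $f(x)\in\phi(x)\setminus\psi_m(x)$ for all $x\in X$; (c) whenever $Y$ is a Banach space, $\phi\colon X\to\mathcal F_c(Y)$ is lower semi-continuous, and $\{F_n\}_{n\in\mathbb N}$ is a decreasing sequence of closed sets $F_n\subset Y$ which is a $Z$-sequence for $\phi$ (i.e. $\phi(x)\cap F_n$ is a $Z_{n-1}$-set in $\phi(x)$ for all $x\in X$, $n\in\mathbb N$), there exist $m$ and a continuous $f\colon X\to Y$ with $f(x)\in\phi(x)\setminus F_m$ for all $x\in X$.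
   Context: All spaces are Tychonoff. A set is functionally open if it is a cozero set. A space $X$ is a finite $C$-space if for every sequence $\{\omega_n\}$ of finite covers of $X$ by functionally open sets there exist $k$ and finite families $\gamma_1,\dots,\gamma_k$ of pairwise disjoint functionally open sets such that each $\gamma_n$ refines $\omega_n$ and $\bigcup_{n=1}^k\gamma_n$ covers $X$. $\mathcal F(Y)$ denotes the nonempty closed subsets of $Y$ and $\mathcal F_c(Y)$ its convex members. $\theta\colon X\to 2^Y$ is lower semi-continuous if $\{x:\theta(x)\cap U\ne\emptyset\}$ is open for every open $U\subset Y$. For $n\ge0$, a closed $F\subset Y$ is a $Z_n$-set in $Y$ if $C(I^n,Y\setminus F)$ is dense in $C(I^n,Y)$ (compact-open topology, $I=[0,1]$). A sequence $\psi_n\colon X\to 2^Y$ is a $Z$-sequence for $\phi$ if $\phi(x)\cap\psi_n(x)$ is a $Z_{n-1}$-set in $\phi(x)$ for all $x\in X$, $n\in\mathbb N$; it is decreasing if $\psi_{n+1}(x)\subset\psi_n(x)$ for all $x,n$. *)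

(* Defs.v *)
From mathcomp Require Import all_boot all_order all_algebra.
From mathcomp Require Import all_classical all_reals all_analysis.
From mathcomp Require Import Rstruct Rstruct_topology.
Set Implicit Arguments. Unset Strict Implicit. Unset Printing Implicit Defensive.
Import Order.TTheory GRing.Theory Num.Theory.
Local Open Scope classical_set_scope.
Local Open Scope ring_scope.

Notation RR := Rdefinitions.R.

Definition tychonoff_space (X : topologicalType) : Prop :=
  accessible_space X /\
  forall (a : X) (B : set X), closed B -> ~ B a ->
    exists f : X -> RR, continuous f /\ f a = 0 /\ (forall b, B b -> f b = 1).

Definition locally_finite_family (X : topologicalType) (V : set (set X)) : Prop :=
  forall x : X, exists2 N, nbhs x N & finite_set [set W | V W /\ W `&` N !=set0].

Definition paracompact (X : topologicalType) : Prop :=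
  tychonoff_space X /\
  forall U : set (set X), (forall W, U W -> open W) -> \bigcup_(W in U) W = setT ->
    exists V : set (set X),
      [/\ forall W, V W -> open W,
          \bigcup_(W in V) W = setT,
          forall W, V W -> exists2 W', U W' & W `<=` W' &
          locally_finite_family V].

Definition functionally_open (X : topologicalType) (U : set X) : Prop :=
  exists f : X -> RR, continuous f /\ U = [set x | f x != 0].

(* finite families of subsets are represented as lists; membership is List.In *)
Definition fo_cover (X : topologicalType) (w : seq (set X)) : Prop :=
  (forall U, List.In U w -> functionally_open U) /\
  (forall x : X, exists2 U, List.In U w & U x).

Definition fam_refines (X : Type) (g w : seq (set X)) : Prop :=
  forall U, List.In U g -> exists2 V, List.In V w & U `<=` V.

Definition fam_disjoint (X : Type) (g : seq (set X)) : Prop :=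
  forall U V, List.In U g -> List.In V g -> U <> V -> U `&` V = set0.

(* finite C-space; the paper's omega_1, omega_2, ... is [w 0], [w 1], ... and
   gamma_1..gamma_k is [g 0], ..., [g (k-1)] *)
Definition finite_C_space (X : topologicalType) : Prop :=
  forall w : nat -> seq (set X), (forall n, fo_cover (w n)) ->
    exists (k : nat) (g : nat -> seq (set X)),
      (forall n, (n < k)%N ->
         [/\ forall U, List.In U (g n) -> functionally_open U,
             fam_disjoint (g n) &
             fam_refines (g n) (w n)]) /\
      (forall x : X, exists n, (n < k)%N /\ exists2 U, List.In U (g n) & U x).

Definition lsc_setmap (X Y : topologicalType) (phi : X -> set Y) : Prop :=
  forall U : set Y, open U -> open [set x | phi x `&` U !=set0].

Definition closed_graph (X Y : topologicalType) (psi : X -> set Y) : Prop :=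
  closed [set p : X * Y | psi p.1 p.2].

Definition convex_subset (Y : lmodType RR) (A : set Y) : Prop :=
  forall a b : Y, A a -> A b -> forall t : RR, 0 <= t -> t <= 1 ->
    A (t *: a + (1 - t) *: b).

Definition closed_nonempty (Y : topologicalType) (A : set Y) : Prop :=
  closed A /\ A !=set0.

Definition closed_convex_nonempty (Y : normedModType RR) (A : set Y) : Prop :=
  closed A /\ A !=set0 /\ convex_subset A.

Definition cube (n : nat) : set 'rV[RR]_n :=
  [set v | forall i : 'I_n, 0 <= v ord0 i <= 1].
Arguments cube : clear implicits.

(* Basic open sets of the compact-open topology on C(I^n, A), A a subspace of
   Y: finite intersections of subbasic sets {h | h(K) ⊆ U}, K compact in I^n,
   U open in A (U = A ∩ V, V open in Y).  For maps into A, h(K) ⊆ A ∩ V iff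
   h(K) ⊆ V.  A continuous map g : I^n -> A is represented by a function
   'rV_n -> Y, continuous on the cube and mapping the cube into A. *)
Definition cont_cube_map (Y : topologicalType) (n : nat) (A : set Y)
    (g : 'rV[RR]_n -> Y) : Prop :=
  {within cube n, continuous g} /\ g @` cube n `<=` A.
Arguments cont_cube_map {Y} n A g.

(* F is a Z_n-set in the space A (F closed in A, and C(I^n, A \ F) is dense in
   C(I^n, A) for the compact-open topology) *)
Definition Zn_set_in (Y : topologicalType) (n : nat) (A F : set Y) : Prop :=
  F `<=` A /\ (exists2 C, closed C & F = A `&` C) /\
  forall g : 'rV[RR]_n -> Y, cont_cube_map n A g ->
  forall s : seq (set 'rV[RR]_n * set Y),
    (forall p, List.In p s ->
       [/\ compact p.1, p.1 `<=` cube n, open p.2 & g @` p.1 `<=` p.2]) ->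
    exists h : 'rV[RR]_n -> Y, cont_cube_map n (A `\` F) h /\
      (forall p, List.In p s -> h @` p.1 `<=` p.2).

(* Z-sequence for phi; the paper's psi_1, psi_2, ... is psi 0, psi 1, ..., so
   "phi x ∩ psi_n x is a Z_{n-1}-set" becomes "phi x ∩ psi n x is Z_n". *)
Definition zseq_for (X Y : topologicalType) (phi : X -> set Y)
    (psi : nat -> X -> set Y) : Prop :=
  forall (x : X) (n : nat), Zn_set_in n (phi x) (phi x `&` psi n x).

Definition decreasing_family (X Y : Type) (psi : nat -> X -> set Y) : Prop :=
  forall (x : X) (n : nat), psi n.+1 x `<=` psi n x.

(* Main.v *)
Require Import Defs.
From HB Require Import structures.
From mathcomp Require Import all_boot all_order all_algebra.
From mathcomp Require Import all_classical all_reals all_analysis.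
From mathcomp Require Import Rstruct Rstruct_topology.
From mathcomp Require Import finmap zify ring lra.
Set Implicit Arguments. Unset Strict Implicit. Unset Printing Implicit Defensive.
Import Order.TTheory GRing.Theory Num.Theory.
Import numFieldNormedType.Exports.
Local Open Scope classical_set_scope.
Local Open Scope ring_scope.

(** A selection of [phi] avoiding [psi m] is glued from local ones along the
    nerve of a sequence of covers. Michael's theorem extends any finite family of
    points of [phi x] to selections, and the [Z]-set condition makes it possible to
    choose, for covers [V 0, V 1, ...] fine enough, selections parametrized by the
    simplices with vertices in [V 0, ..., V n] and avoiding [psi n]: simplices of
    dimension [n] are treated when [V n] is chosen, because the intersection with
    [psi n] is a [Z_n]-set there. If finitely many disjoint families refining the
    [V n] cover the space, a partition of unity subordinate to them maps it into
    these simplices.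

    The [V n] are infinite, whereas finite [C]-spaces are defined by finite
    covers. The gap is bridged as follows. A continuous [f : X -> R] exhausting a
    countable cover has annuli [j <= f <= j + 1] that have uniformly bounded
    dimension for large [j], for otherwise bad pairs of closed sets on far apart
    annuli would combine into a sequence violating the finite [C] property. On
    the region where [f] is large, even and odd annuli are thus handled by
    boundedly many families, and only finitely many cover elements remain.

    Conversely, finite covers [w n] are encoded in the Banach space of bounded
    functions on [nat * nat]: [phi x] consists of the weights [y (n, i)] supported
    by the members of [w n] that contain [x], and [F m] of the [y] having no
    unique positive maximal weight on any level [n <= m]. The points where [i]
    carries the unique maximal weight on level [n] form disjoint families. That
    [F m] meets [phi x] in a [Z_m]-set follows from colouring the [m]-cube by
    [m + 1] disjoint families of small cells. *)

(** * Locally finite families and partitions of unity *)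

Section Continuity.
Variable X : topologicalType.

Section Module.
Variables (E : normedModType RR) (f g : X -> E).
Hypotheses (cf : continuous f) (cg : continuous g).

Lemma contD : continuous (fun x => f x + g x).
Proof. by move=> x; apply: cvgD; [exact: cf|exact: cg]. Qed.

Lemma contB : continuous (fun x => f x - g x).
Proof. by move=> x; apply: cvgB; [exact: cf|exact: cg]. Qed.

Lemma contZ (a : X -> RR) : continuous a -> continuous (fun x => a x *: f x).
Proof. by move=> ca x; apply: cvgZ; [exact: ca|exact: cf]. Qed.

Lemma cont_norm : continuous (fun x => `|f x|).
Proof. by move=> x; apply: cvg_norm; exact: cf. Qed.

End Module.

Lemma cont_sum (E : normedModType RR) (I : Type) (r : seq I) (P : pred I)
    (F : I -> X -> E) :
  (forall i, continuous (F i)) -> continuous (fun x => \sum_(i <- r | P i) F i x).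
Proof.
move=> cF x.
apply: (@cvg_big E I +%R 0 P (@add_continuous E) X (nbhs x) r F (F^~ x)).
by move=> i _; exact: cF.
Qed.

Section Real.
Variables f g : X -> RR.
Hypotheses (cf : continuous f) (cg : continuous g).

Lemma rcontB : continuous (fun x => f x - g x).
Proof. exact: (@contB RR^o). Qed.

Lemma rcontM : continuous (fun x => f x * g x).
Proof. by move=> x; apply: cvgM; [exact: cf|exact: cg]. Qed.

Lemma rcontV : (forall x, f x != 0) -> continuous (fun x => (f x)^-1).
Proof. by move=> f0 x; apply: cvgV => //; exact: cf. Qed.

Lemma rcont_norm : continuous (fun x => `|f x|).
Proof. exact: (@cont_norm RR^o). Qed.

Lemma rcont_max : continuous (fun x => Num.max (f x) (g x)).
Proof. by move=> x; apply: continuous_max; [exact: cf|exact: cg]. Qed.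

Lemma rcont_min : continuous (fun x => Num.min (f x) (g x)).
Proof. by move=> x; apply: continuous_min; [exact: cf|exact: cg]. Qed.

Lemma open_ltfun : open [set x | f x < g x].
Proof.
rewrite (_ : [set x | _] = (fun x => g x - f x) @^-1` [set r | 0 < r]).
  apply: open_comp => [x _|]; last exact: open_gt.
  by apply: (@cvgB _ RR^o); [exact: cg|exact: cf].
by apply/seteqP; split=> x /=; rewrite subr_gt0.
Qed.

End Real.

Lemma closed_lefun (f g : X -> RR) : continuous f -> continuous g ->
  closed [set x | f x <= g x].
Proof.
move=> cf cg; rewrite (_ : [set x | _] = ~` [set x | g x < f x]).
  exact/open_closedC/open_ltfun.
by apply/seteqP; split=> x /=; [move=> h /lt_geF|move/negP]; rewrite -?leNgt ?h.
Qed.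

Lemma rcont_sum (I : Type) (r : seq I) (P : pred I) (F : I -> X -> RR) :
  (forall i, continuous (F i)) -> continuous (fun x => \sum_(i <- r | P i) F i x).
Proof. exact: (@cont_sum RR^o). Qed.

Lemma cont_cst (Z : topologicalType) (z : Z) : continuous (fun _ : X => z).
Proof. by move=> x; exact: cvg_cst. Qed.

End Continuity.

Section LocallyFinite.
Variables (X : topologicalType) (I : Type).

(** Indices are counted rather than sets, so a nonempty set repeated under infinitely many indices
    of [P] is excluded. *)
Definition lfin (P : set I) (V : I -> set X) : Prop :=
  forall x : X, exists2 N, nbhs x N & finite_set [set i | P i /\ V i `&` N !=set0].

Lemma lfinS (P : set I) (V W : I -> set X) :
  (forall i, P i -> W i `<=` V i) -> lfin P V -> lfin P W.
Proof.
move=> WV Vf x; have [N xN fN] := Vf x; exists N => //.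
apply: sub_finite_set fN => i [Pi [y [Wy Ny]]]; split=> //.
by exists y; split=> //; exact: WV Wy.
Qed.

Lemma near_finite (x : X) (D : set I) (A : I -> set X) : finite_set D ->
  (forall i, D i -> nbhs x (A i)) -> nbhs x [set y | forall i, D i -> A i y].
Proof.
(* Equips the index type with a choice structure, so that [D] becomes an [fset] over which
   neighbourhoods can be intersected. *)
elim/Pchoice: I => J in D A *.
move=> fD nA; have nA' i : i \in fset_set D -> nbhs x (A i).
  by rewrite in_fset_set // => /set_mem; exact: nA.
apply: filterS (filter_bigI _ nA').
by move=> y Hy i Di; apply: Hy; rewrite /= in_fset_set //; exact: mem_set.
Qed.

(** Only the finitely many members that meet [N] matter near [x]; if [x] is outside all their
    closures, a smaller neighbourhood misses the whole union. *)
Lemma lfin_closure (P : set I) (V : I -> set X) x : lfin P V ->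
  closure (\bigcup_(i in P) V i) x -> exists2 i, P i & closure (V i) x.
Proof.
move=> Vf clx; apply: contrapT => nex.
have [N xN fN] := Vf x.
have : nbhs x [set y | forall i, (P i /\ V i `&` N !=set0) -> (~` closure (V i)) y].
  apply: near_finite => // i [Pi _]; apply: open_nbhs_nbhs; split.
    exact/closed_openC/closed_closure.
  by move=> ci; apply: nex; exists i.
move=> /(filterI xN) /clx[y [[i Pi Vy] [Ny /(_ i)]]]; apply.
  by split=> //; exists y.
exact: subset_closure.
Qed.

Lemma lfin_bigcup_closed (P : set I) (V : I -> set X) : lfin P V ->
  (forall i, P i -> closed (V i)) -> closed (\bigcup_(i in P) V i).
Proof.
move=> Vf Vc x /(lfin_closure Vf)[i Pi clx]; exists i => //.
exact: Vc.
Qed.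

End LocallyFinite.

Section Paracompact.
Variable X : topologicalType.

Lemma tychonoff_regular (a : X) (O : set X) : tychonoff_space X ->
  open O -> O a -> exists2 W, open W & W a /\ closure W `<=` O.
Proof.
move=> [_ tX] oO Oa; have [|f [cf [fa f1]]] := tX a (~` O) (open_closedC oO).
  by move=> /=; apply.
exists (f @^-1` [set r | r < 1/2]).
  by apply: open_comp => [x _|]; [exact: cf | exact: open_lt].
split=> /=; first by rewrite fa; lra.
have cl : closed (f @^-1` [set r | r <= 1/2]).
  by apply: preimage_closed => //; exact: closed_le.
move=> x /(@closureS _ _ (f @^-1` [set r | r <= 1/2])) clx.
have : (f @^-1` [set r : RR | r <= 1/2]) x.
  by apply: cl; apply: clx => y /= /ltW.
rewrite /= => fx; apply: contrapT => /f1 fx1; rewrite fx1 in fx; lra.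
Qed.

Hypothesis hX : paracompact X.

(** A locally finite refinement of the open sets whose closure fits into some [O i] is regrouped
    along a chosen index. By local finiteness the closure of a group is the union of the closures,
    hence still inside [O i]. *)
Lemma paracompact_shrink (I : Type) (O : I -> set X) :
  (forall i, open (O i)) -> (forall x, exists i, O i x) ->
  exists V : I -> set X, [/\ forall i, open (V i),
    forall i, closure (V i) `<=` O i, forall x, exists i, V i x & lfin setT V].
Proof.
move=> oO cO; case: hX => tX pX.
have [||V [oV cV rV fV]] := pX [set W | open W /\ exists i, closure W `<=` O i].
- by move=> W [].
- apply/seteqP; split=> // x _; have [i Oi] := cO x.
  have [W oW [Wx clW]] := tychonoff_regular tX (oO i) Oi.
  by exists W => //; split=> //; exists i.
(* Sets outside [V] receive [None], since [I] may have no default element. *)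
have /choice[idx idxP] : forall W, exists oi : option I,
    V W -> exists2 i, oi = Some i & closure W `<=` O i.
  move=> W; case: (pselect (V W)) => VW; last by exists None.
  have [W' [_ [i cl]] WW'] := rV _ VW; exists (Some i) => _; exists i => //.
  exact: subset_trans (closureS WW') cl.
exists (fun i => \bigcup_(W in [set W | V W /\ idx W = Some i]) W); split.
- by move=> i; apply: bigcup_open => W [VW _]; exact: oV.
- move=> i x; have lf : lfin [set W | V W /\ idx W = Some i] id.
    move=> y; have [N yN fN] := fV y; exists N => //.
    by apply: sub_finite_set fN => W [[VW _] WN].
  move=> /(lfin_closure lf)[W [VW iW] clW].
  by have [j] := idxP _ VW; rewrite iW => -[->]; apply.
- move=> x; have : (\bigcup_(W in V) W) x by rewrite cV.
  move=> [W VW Wx]; have [i iW _] := idxP _ VW; by exists i, W.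
- move=> x; have [N xN fN] := fV x; exists N => //.
  have : finite_set (Some @^-1` (idx @` [set W | V W /\ W `&` N !=set0])).
    apply: finite_preimage; first by move=> ? ? _ _ [].
    exact: finite_image.
  apply: sub_finite_set => i [_ [y [[W [VW iW] Wy] Ny]]].
  by exists W => //; split=> //; exists y.
Qed.

(** The cover by the two complements is shrunk: [A] then lies in [V true], whose closure misses
    [B]. *)
Lemma paracompact_normal : normal_space X.
Proof.
apply/(@normal_openP RR) => A B cA cB AB.
pose O (b : bool) := if b then ~` B else ~` A.
have [||V [oV clV cV _]] := @paracompact_shrink bool O.
- by case; exact: closed_openC.
- move=> x; case: (pselect (A x)) => Ax; last by exists false.
  by exists true => Bx; rewrite -[False]/(set0 x) -AB.
exists (V true), (~` closure (V true)); split=> //.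
- exact/closed_openC/closed_closure.
- move=> x Ax; have [[//|/subset_closure Vx]] := cV x.
  by have := clV false _ Vx.
- by move=> x Bx Vx; exact: clV true _ Vx Bx.
- by apply/seteqP; split=> // x [/subset_closure].
Qed.

Lemma normal_urysohn (A B : set X) : normal_space X -> closed A -> closed B ->
  A `&` B = set0 -> exists f : X -> RR, [/\ continuous f,
    forall x, 0 <= f x <= 1, forall x, A x -> f x = 0 & forall x, B x -> f x = 1].
Proof.
move=> nX cA cB AB; have /(@normal_separatorP RR) /(_ _ _ cA cB AB) := nX.
move=> /(@uniform_separatorP _ RR)[f [cf f01 fA fB]]; exists f; split=> //.
- by move=> x; have := f01 (f x) (ex_intro2 _ _ x I erefl); rewrite /= in_itv.
- by move=> x Ax; apply: (fA (f x)); exists x.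
- by move=> x Bx; apply: (fB (f x)); exists x.
Qed.

Lemma lfin_sum_cont (I : choiceType) (E : normedModType RR) (F : I -> X -> E) :
  lfin setT (fun i => [set x | F i x != 0]) -> (forall i, continuous (F i)) ->
  continuous (fun x => \sum_(i \in [set: I]) F i x).
Proof.
move=> lF cF x; have [N xN fN] := lF x.
pose A := fset_set [set i | setT i /\ [set x | F i x != 0] `&` N !=set0].
have eqs y : N y -> \sum_(i \in [set: I]) F i y = \sum_(i <- A) F i y.
  move=> Ny; apply: fsbigTE => i; rewrite in_fset_set // notin_setE /= => nA.
  by apply: contrapT => /eqP Fi; apply: nA; split=> //; exists y.
rewrite /continuous_at (eqs x (nbhs_singleton xN)).
apply: cvg_trans; last first.
  apply: (@cvg_big E I +%R 0 xpredT (@add_continuous E) X (nbhs x) A F (F^~ x)).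
  by move=> i _; exact: cF.
apply: near_eq_cvg; apply: filterS xN => y Ny.
by rewrite /= eqs.
Qed.

(** Two successive shrinkings: a Urysohn function equal to [1] on the closure of [W i] and to [0]
    off [V i] has its closed support inside [O i]. The locally finite sum is positive because [W]
    covers, so it can be divided out. *)
Lemma partition_of_unity (I : choiceType) (O : I -> set X) :
  (forall i, open (O i)) -> (forall x, exists i, O i x) ->
  exists p : I -> X -> RR, [/\ forall i, continuous (p i),
    forall i x, 0 <= p i x,
    forall i, closure [set x | p i x != 0] `<=` O i,
    lfin setT (fun i => [set x | p i x != 0]) &
    forall x, \sum_(i \in [set: I]) p i x = 1].
Proof.
move=> oO cO; have [V [oV clV cV lV]] := paracompact_shrink oO cO.
have [W [oW clW cW lW]] := paracompact_shrink oV cV.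
have /choice[q qP] : forall i, exists f : X -> RR, [/\ continuous f,
    forall x, 0 <= f x <= 1, forall x, (~` V i) x -> f x = 0 &
    forall x, closure (W i) x -> f x = 1].
  move=> i; apply: normal_urysohn; first exact: paracompact_normal.
  - exact: open_closedC.
  - exact: closed_closure.
  - by apply/seteqP; split=> // x [nV /clW].
have q0 i x : 0 <= q i x by have [_ /(_ x)/andP[]] := qP i.
have qV i : [set x | q i x != 0] `<=` V i.
  move=> x /= /eqP qx; apply: contrapT => nV; apply: qx.
  by have [_ _ + _] := qP i; apply.
have lq : lfin setT (fun i => [set x | q i x != 0]).
  by apply: lfinS lV => i _; exact: qV.
pose s x := \sum_(i \in [set: I]) q i x.
have cs : continuous s by apply: (@lfin_sum_cont I RR^o) => // i; have [] := qP i.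
have fs x : finite_set (setT `&` (q^~ x @^-1` [set~ 0])).
  have [N xN fN] := lq x; apply: sub_finite_set fN => i [_ /= qi].
  by split=> //; exists x; split; [exact/eqP|exact: nbhs_singleton].
have s0 x : 0 < s x.
  have [i Wi] := cW x; have qi : q i x = 1.
    by have [_ _ _] := qP i; apply; exact: subset_closure.
  rewrite /s fsbig_supp (fsbigD1 i); [|exact: fs|]; last first.
    by split=> //=; rewrite qi; exact/eqP/oner_neq0.
  by rewrite qi; apply: ltr_pwDl => //; apply: fsumr_ge0.
exists (fun i x => (s x)^-1 * q i x); split.
- move=> i x; apply: cvgM; last by have [+ _ _ _] := qP i; exact.
  by apply: cvgV; [rewrite gt_eqF | exact: cs].
- by move=> i x; rewrite mulr_ge0 // invr_ge0 ltW.
- move=> i x clx; apply: clV; apply: closureS clx => y /=.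
  by rewrite mulf_eq0 negb_or => /andP[_ /qV].
- apply: lfinS lq => i _ x /=.
  by rewrite mulf_eq0 negb_or => /andP[].
- by move=> x; rewrite -mulr_fsumr mulVf // gt_eqF.
Qed.

End Paracompact.

(** * Michael's selection theorem *)

Section Michael.

Lemma convex_comb_lt (a b e t : RR) : a < e -> b < e -> 0 <= t -> t <= 1 ->
  t * a + (1 - t) * b < e.
Proof. by move=> ae be; rewrite le_eqVlt => /orP[/eqP <-|t0]; [lra|nra]. Qed.

Lemma convex_combination (Y : lmodType RR) (A : set Y) (I : eqType) (r : seq I)
    (p : I -> RR) (y : I -> Y) : convex_subset A -> (forall i, 0 <= p i) ->
  (forall i, p i != 0 -> A (y i)) -> \sum_(i <- r) p i = 1 ->
  A (\sum_(i <- r) p i *: y i).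
Proof.
move=> cA p0 pA.
(* The weights of a sublist need not sum to [1], so the induction runs on normalized sums of
   positive total weight. *)
suff H : 0 < \sum_(i <- r) p i ->
    A ((\sum_(i <- r) p i)^-1 *: \sum_(i <- r) p i *: y i).
  by move=> s1; move: H; rewrite s1 invr1 scale1r; apply.
elim: r => [|i r IH]; first by rewrite big_nil ltxx.
rewrite !big_cons; have [pi0|pi0] := eqVneq (p i) 0.
  by rewrite pi0 scale0r !add0r.
have s0 : 0 <= \sum_(j <- r) p j by apply: sumr_ge0.
have pi1 : 0 < p i by rewrite lt_def pi0 p0.
have [s1 _|s1] := eqVneq (\sum_(j <- r) p j) 0.
  have -> : \sum_(j <- r) p j *: y j = 0.
    rewrite big1_seq // => j /= jr; have /eqP := s1.
    rewrite psumr_eq0 // => /allP /(_ j jr) /=.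
    by move=> /eqP ->; rewrite scale0r.
  by rewrite s1 !addr0 scalerA mulVf // scale1r; exact: pA.
set s := \sum_(j <- r) p j in s0 s1 IH *; set S := \sum_(j <- r) _ in IH *.
have sp : 0 < s by rewrite lt_def s1 s0.
move=> ss; have := cA (y i) (s^-1 *: S) (pA i pi0) (IH sp) (p i / (p i + s)).
have -> : p i / (p i + s) *: y i + (1 - p i / (p i + s)) *: (s^-1 *: S) =
   (p i + s)^-1 *: (p i *: y i + S).
  rewrite scalerDr !scalerA mulrC; congr (_ + _ *: _).
  by field; rewrite s1 gt_eqF.
apply; first by rewrite divr_ge0 // ltW.
by rewrite ler_pdivrMr // mul1r lerDl.
Qed.

Variables (X : topologicalType) (hX : paracompact X).

(** The partition of unity is indexed by the points [y] of [Y], with [p y] supported where [phi x]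
    comes within [e] of [y]. The value at [x] is a convex combination of such points, and the points
    within [e] of the convex set [phi x] form a convex set [B]. *)
Lemma approximate_selection (Y : normedModType RR) (phi : X -> set Y) (e : RR) :
  (forall x, phi x !=set0) -> (forall x, convex_subset (phi x)) ->
  lsc_setmap phi -> 0 < e ->
  exists2 f : X -> Y, continuous f &
    forall x, exists2 y, phi x y & `|f x - y| < e.
Proof.
move=> ne cv lsc e0.
pose O (y : Y) := [set x | phi x `&` [set z | `|y - z| < e] !=set0].
have oO y : open (O y).
  by apply: lsc; have := @ball_open _ Y y e; rewrite -ball_normE.
have [|p [cp p0 sp lp p1]] := partition_of_unity hX oO.
  by move=> x; have [y py] := ne x; exists y, y; rewrite /= subrr normr0.
exists (fun x => \sum_(y \in [set: Y]) p y x *: y).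
  apply: (@lfin_sum_cont X Y Y (fun y x => p y x *: y)).
    apply: lfinS lp => y _ x /=.
    by rewrite scaler_eq0 negb_or => /andP[].
  move=> y; apply: contZ => //; exact: cont_cst.
move=> x; have [N xN fN] := lp x.
pose A := fset_set [set i | setT i /\ [set x | p i x != 0] `&` N !=set0].
have pA i : i \notin A -> p i x = 0.
  rewrite in_fset_set // notin_setE /= => nA.
  apply: contrapT => /eqP Fi; apply: nA; split=> //; exists x; split=> //.
  exact: nbhs_singleton.
have -> : \sum_(y \in [set: Y]) p y x *: y = \sum_(y <- A) p y x *: y.
  by apply: fsbigTE => i /pA ->; rewrite scale0r.
have := p1 x; rewrite (fsbigTE A) // => s1.
pose B := [set z : Y | exists2 y, phi x y & `|z - y| < e].
have cB : convex_subset B.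
  move=> a b [a' pa ea] [b' pb eb] t t0 t1; exists (t *: a' + (1 - t) *: b').
    exact: cv.
  have -> : t *: a + (1 - t) *: b - (t *: a' + (1 - t) *: b') =
     t *: (a - a') + (1 - t) *: (b - b').
    by rewrite !scalerBr opprD addrACA.
  apply: le_lt_trans (ler_normD _ _) _; rewrite !normrZ ger0_norm //.
  rewrite ger0_norm ?subr_ge0 //.
  exact: convex_comb_lt.
apply: (convex_combination cB) s1 => // i pi.
have [|y [py yi]] := sp i x; first exact: subset_closure.
by exists y.
Qed.

Lemma lsc_ball (Y : normedModType RR) (phi : X -> set Y) (f : X -> Y) (r : RR) :
  lsc_setmap phi -> continuous f ->
  lsc_setmap (fun x => phi x `&` [set y | `|f x - y| < r]).
Proof.
move=> lsc cf U oU; rewrite openE => x [y [[py /= fy] Uy]].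
have /nbhs_ballP[d1 /= d1p dU] : nbhs y U by exact: open_nbhs_nbhs.
(* The slack in [|f x - y| < r] is shared by the moves from [f x] to [f x'] and from [y] to [z]; the
   bound [d1] keeps [z] in [U]. *)
pose d := Num.min d1 ((r - `|f x - y|) / 2).
have dp : 0 < d by rewrite lt_min d1p divr_gt0 // subr_gt0.
have oB : open (ball y d) by exact: ball_open.
have n1 : nbhs x [set x' | phi x' `&` ball y d !=set0].
  apply: open_nbhs_nbhs; split; first exact: lsc.
  by exists y; split=> //; exact: ballxx.
have n2 : nbhs x [set x' | `|f x - f x'| < d].
  have /cvgrPdist_lt := cf x; exact.
apply: filterS2 n1 n2 => x' [z [pz]]; rewrite -ball_normE /= => yz fx.
exists z; split; last first.
  by apply: dU; rewrite -ball_normE /=; apply: lt_le_trans yz _; rewrite ge_min lexx.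
split=> //=.
have -> : f x' - z = (f x - y) + ((y - z) - (f x - f x')).
  by rewrite addrA subrKA opprB addrC addrA subrK.
apply: le_lt_trans (ler_normD _ _) _.
have := ler_normB (y - z) (f x - f x').
have : d <= (r - `|f x - y|) / 2 by rewrite ge_min lexx orbT.
lra.
Qed.

(** Successive approximations: the next map is an approximate selection, with error halved, of [phi]
    cut down to points close to the present map. The maps are uniformly Cauchy, and the limit lies
    in the closed sets [phi x]. *)
Lemma michael_selection (Y : completeNormedModType RR) (phi : X -> set Y) :
  (forall x, closed_convex_nonempty (phi x)) -> lsc_setmap phi ->
  exists2 f : X -> Y, continuous f & forall x, phi x (f x).
Proof.
move=> ccn lsc.
have ne x : phi x !=set0 by have [_ []] := ccn x.
have cv x : convex_subset (phi x) by have [_ []] := ccn x.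
pose h n : RR := 2^-1 ^+ n.
have h0 n : 0 < h n by rewrite exprn_gt0 // invr_gt0.
have hS n : h n.+1 = h n / 2 by rewrite /h exprSr.
pose good n (f : X -> Y) := continuous f /\ forall x, exists2 y, phi x y & `|f x - y| < h n.
have [f0 cf0 af0] := approximate_selection ne cv lsc (h0 0%N).
have /choice[nxt nxtP] : forall nf : nat * (X -> Y), exists g : X -> Y,
    good nf.1 nf.2 -> good nf.1.+1 g /\ forall x, `|nf.2 x - g x| < 2 * h nf.1.
  move=> [n f]; case: (pselect (good n f)) => [[cf af]|]; last by exists f.
  have [||||g cg ag] := @approximate_selection Y
      (fun x => phi x `&` [set y | `|f x - y| < h n]) (h n.+1) => //.
  - by move=> x; have [y py fy] := af x; exists y.
  - move=> x a b [pa /= fa] [pb /= fb] t t0 t1; split; first exact: cv.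
    have -> : f x - (t *: a + (1 - t) *: b) = t *: (f x - a) + (1 - t) *: (f x - b).
      rewrite !scalerBr addrACA -opprD; congr (_ - _).
      by rewrite -scalerDl addrC subrK scale1r.
    apply: le_lt_trans (ler_normD _ _) _; rewrite !normrZ ger0_norm //.
    rewrite ger0_norm ?subr_ge0 //.
    exact: convex_comb_lt.
  - exact: lsc_ball.
  exists g => _; split; first split=> //.
    by move=> x; have [y [py _] gy] := ag x; exists y.
  move=> x; have [y [py /= fy] gy] := ag x; rewrite /= in gy *.
  have -> : f x - g x = (f x - y) - (g x - y) by rewrite opprB addrA subrK.
  apply: le_lt_trans (ler_normB _ _) _.
  have := h0 n; rewrite hS in gy; lra.
pose f := fix f n := if n is m.+1 then nxt (m, f m) else f0.
have gf n : good n (f n).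
  by elim: n => [|n IH]; [split|exact: (nxtP (n, f n) IH).1].
have df n x : `|f n x - f n.+1 x| < 2 * h n by exact: (nxtP (n, f n) (gf n)).2.
(* The increment [2 * h k] equals [4 * h k - 4 * h k.+1], so the bounds telescope. *)
have dfm n m x : `|f n x - f (n + m)%N x| <= 4 * h n - 4 * h (n + m)%N.
  elim: m => [|m IH]; first by rewrite addn0 !subrr normr0.
  rewrite addnS; have -> : f n x - f (n + m).+1 x =
    (f n x - f (n + m)%N x) + (f (n + m)%N x - f (n + m).+1 x) by rewrite addrA subrK.
  apply: le_trans (ler_normD _ _) _.
  have := df (n + m)%N x; rewrite hS; lra.
have hlim : h n @[n --> \oo] --> (0 : RR).
  by apply: cvg_expr; rewrite ger0_norm ?invr_ge0 // invf_lt1 // ltr1n.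
have hs (e : RR) : 0 < e -> exists n, h n < e.
  move=> e0; have /(@cvgrPdist_lt _ RR^o) /(_ e e0) [n _ nP] := hlim.
  by exists n; have := nP n (leqnn n); rewrite /= sub0r normrN gtr0_norm.
have cvgf x : cvgn (fun n => f n x).
  apply: cauchy_cvg; apply/cauchy_exP => e e0.
  have [|n hn] := hs (e / 4); first by rewrite divr_gt0.
  exists (f n x), n => // m /= nm; rewrite -ball_normE /=.
  rewrite -(subnKC nm); apply: le_lt_trans (dfm _ _ _) _.
  by have := h0 (n + (m - n))%N; lra.
pose g x := limn (fun n => f n x).
have dg n x : `|f n x - g x| <= 4 * h n.
  have cl : closed [set z : Y | `|f n x - z| <= 4 * h n].
    apply: closed_lefun; last exact: cont_cst.
    by apply: cont_norm; apply: contB; [exact: cont_cst|move=> ?; exact: cvg_id].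
  have nr : \forall m \near \oo, `|f n x - f m x| <= 4 * h n.
    exists n => // m /= nm.
    rewrite -(subnKC nm); apply: le_trans (dfm _ _ _) _.
    by have := h0 (n + (m - n))%N; lra.
  exact: (closed_cvg _ cl nr _ (cvgf x)).
exists g.
  move=> x; apply/cvgrPdist_lt => e e0.
  have [|n hn] := hs (e / 12); first by rewrite divr_gt0.
  have /cvgrPdist_lt /(_ (e / 3)) := (gf n).1 x; rewrite divr_gt0 // => /(_ isT).
  apply: filterS => x' fx.
  have := ler_distD (f n x) (g x) (g x'); have := ler_distD (f n x') (f n x) (g x').
  by rewrite (distrC (g x) (f n x)); have := dg n x; have := dg n x'; lra.
move=> x; have [clx _] := ccn x; apply: clx => B /nbhs_ballP[e /= e0 eB].
have [|n hn] := hs (e / 5); first by rewrite divr_gt0.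
have [y py fy] := (gf n).2 x; exists y; split=> //; apply: eB.
rewrite -ball_normE /=.
by have := ler_distD (f n x) (g x) y; rewrite (distrC (g x) (f n x)); have := dg n x; lra.
Qed.

(** Replacing [phi x0] by the singleton of [y0] keeps lower semi-continuity: for an open [U]
    containing [y0] the set of points is the old one, otherwise it only loses the closed point
    [x0]. *)
Lemma michael_selection_through (Y : completeNormedModType RR) (phi : X -> set Y)
    (x0 : X) (y0 : Y) :
  (forall x, closed_convex_nonempty (phi x)) -> lsc_setmap phi -> phi x0 y0 ->
  exists f : X -> Y, [/\ continuous f, forall x, phi x (f x) & f x0 = y0].
Proof.
move=> ccn lsc py0; have [[aX _] _] := hX.
pose phi' x := if pselect (x = x0) then [set y0] else phi x.
have phi'0 : phi' x0 = [set y0] by rewrite /phi'; case: pselect.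
have phi'n x : x <> x0 -> phi' x = phi x by rewrite /phi'; case: pselect.
have [||f cf sf] := @michael_selection Y phi'.
- move=> x; have [->|/eqP/phi'n ->] := eqVneq x x0; last exact: ccn.
  rewrite phi'0; split.
    apply: accessible_closed_set1; apply: hausdorff_accessible.
    exact: norm_hausdorff.
  split; first by exists y0.
  by move=> a b -> -> t t0 t1 /=; rewrite -scalerDl addrC subrK scale1r.
- move=> U oU; case: (pselect (U y0)) => Uy0.
    rewrite (_ : [set x | _] = [set x | phi x `&` U !=set0]); first exact: lsc.
    apply/seteqP; split=> x /=; have [->|/eqP/phi'n -> //] := eqVneq x x0.
      by move=> _; exists y0.
    by move=> _; exists y0; rewrite phi'0.
  rewrite (_ : [set x | _] = [set x | phi x `&` U !=set0] `&` ~` [set x0]).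
    apply: openI; first exact: lsc.
    exact/closed_openC/accessible_closed_set1.
  apply/seteqP; split=> x /=; have [->|/eqP xx0] := eqVneq x x0.
  + by rewrite phi'0 => -[y [-> /Uy0]].
  + by rewrite phi'n.
  + by move=> [_].
  + by rewrite phi'n // => -[].
exists f; split=> // [x|]; last by have := sf x0; rewrite phi'0.
have := sf x; have [->|/eqP/phi'n -> //] := eqVneq x x0.
by rewrite phi'0 => ->.
Qed.

End Michael.

(** * Disjoint refinements in finite C-spaces *)

Section DisjointRefinement.
Variable X : topologicalType.

(** What a single disjoint open family refining [w] can cover. Pieces inside the same member of [w]
    may be united, so indexing them by [I] loses no generality. *)
Definition dsm (I : Type) (w : I -> set X) (D : set X) : Prop :=
  exists g : I -> set X, [/\ forall i, open (g i), forall i, g i `<=` w i,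
    forall i j x, g i x -> g j x -> i = j & forall x, D x <-> exists i, g i x].

Lemma dsm_open (I : Type) (w : I -> set X) D : dsm w D -> open D.
Proof.
move=> [g [og _ _ Dg]]; rewrite (_ : D = \bigcup_i g i); first exact: bigcup_open.
by apply/seteqP; split=> x; [move/Dg => [i gi]; exists i|move=> [i _ gi]; apply/Dg; exists i].
Qed.

Lemma dsmS (I : Type) (w : I -> set X) D D' :
  dsm w D -> open D' -> D' `<=` D -> dsm w D'.
Proof.
move=> [g [og gw dg Dg]] oD DD; exists (fun i => g i `&` D'); split.
- by move=> i; exact: openI.
- by move=> i x [/gw].
- by move=> i j x [gi _] [gj _]; exact: dg gi gj.
- move=> x; split=> [Dx|[i []//]].
  by have /Dg[i gi] := DD _ Dx; exists i.
Qed.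

Lemma dsm_sub (I : Type) (w : I -> set X) D i : open D -> D `<=` w i -> dsm w D.
Proof.
move=> oD Dw; exists (fun j => [set x | D x /\ j = i]); split.
- move=> j; have [->|ji] := pselect (j = i).
    by rewrite (_ : [set x | _] = D) //; apply/seteqP; split=> x //= -[].
  by rewrite (_ : [set x | _] = set0); [exact: open0|apply/seteqP; split=> x //= -[]].
- by move=> j x [/Dw wx ->].
- by move=> j j' x [_ ->] [_ ->].
- by move=> x; split=> [Dx|[j []//]]; exists i.
Qed.

Lemma dsm_bigcup (I A : Type) (w : I -> set X) (P : set A) (D : A -> set X) :
  (forall a, P a -> dsm w (D a)) ->
  (forall a b x, P a -> P b -> D a x -> D b x -> a = b) ->
  dsm w (\bigcup_(a in P) D a).
Proof.
move=> dD djD.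
have /choice[g gP] : forall a, exists g : I -> set X, P a ->
    [/\ forall i, open (g i), forall i, g i `<=` w i,
    forall i j x, g i x -> g j x -> i = j & forall x, D a x <-> exists i, g i x].
  move=> a; have [Pa|nP] := pselect (P a); last by exists (fun _ => set0).
  by have [g gP] := dD a Pa; exists g.
exists (fun i => \bigcup_(a in P) g a i); split.
- by move=> i; apply: bigcup_open => a Pa; have [og _ _ _] := gP a Pa; exact: og.
- by move=> i x [a Pa ga]; have [_ gw _ _] := gP a Pa; exact: gw ga.
- move=> i j x [a Pa ga] [b Pb gb].
  have [_ _ dga Da] := gP a Pa; have [_ _ _ Db] := gP b Pb.
  have ab : a = b by apply: (djD a b x) => //; [apply/Da; exists i|apply/Db; exists j].
  by subst b; exact: dga ga gb.
- move=> x; split=> [[a Pa Dx]|[i [a Pa ga]]].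
    by have [_ _ _ /(_ x)[/(_ Dx)[i gi] _]] := gP a Pa; exists i, a.
  by exists a => //; have [_ _ _ Da] := gP a Pa; apply/Da; exists i.
Qed.

Lemma dsm_trans (I J : Type) (w : I -> set X) (v : J -> set X) D :
  dsm v D -> (forall j, dsm w (v j)) -> dsm w D.
Proof.
move=> [g [og gv dg Dg]] vw; rewrite (_ : D = \bigcup_(j in setT) g j); last first.
  by apply/seteqP; split=> x; [move/Dg => [i gi]; exists i|move=> [i _ gi]; apply/Dg; exists i].
apply: dsm_bigcup => [j _|a b x _ _]; last exact: dg.
by apply: dsmS (vw j) (og j) (gv j).
Qed.

Lemma dsm_cover (I J : Type) (w : I -> set X) (v : J -> set X) D :
  (forall j, open (v j)) -> (forall j, exists i, v j `<=` w i) -> dsm v D -> dsm w D.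
Proof.
move=> ov vw dD; apply: dsm_trans dD _ => j; have [i vi] := vw j.
exact: dsm_sub (ov j) vi.
Qed.

Lemma open_neq0 (f : X -> RR) : continuous f -> open [set x | f x != 0].
Proof.
move=> cf; rewrite (_ : [set x | _] = [set x | 0 < `|f x|]).
  by apply: open_ltfun; [exact: cont_cst|exact: rcont_norm].
by apply/seteqP; split=> x /=; rewrite normr_gt0.
Qed.

End DisjointRefinement.

(** * Barycentric layers of a locally finite family of weights *)

Section Layers.
Variables (X : topologicalType) (J : choiceType) (q : J -> X -> RR).
Hypotheses (cq : forall j, continuous (q j)) (q0 : forall j x, 0 <= q j x)
  (lq : lfin setT (fun j => [set x | q j x != 0])).

(** For nonempty [S] and weights read as barycentric coordinates in the nerve, this is the preimage
    of the open star of the barycenter of [S] in the barycentric subdivision. *)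
Definition layer (S : {fset J}) : set X :=
  [set x | forall i, i \in S -> 0 < q i x /\ forall j, j \notin S -> q j x < q i x].

(** On [N] all but finitely many weights vanish, and against those the positivity of [q i] suffices;
    finitely many strict inequalities remain. *)
Lemma layer_open S : open (layer S).
Proof.
rewrite openE => x Sx; have [N xN fN] := lq x.
set D := [set j | _] in fN.
have n1 : nbhs x [set y | forall i, [set` S] i -> (0 < q i y /\
    forall j, (D `&` ~` [set` S]) j -> q j y < q i y)].
  apply: near_finite; first exact: finite_fset.
  move=> i Si; have [qi qj] := Sx i Si; apply: filterI.
    by apply: open_nbhs_nbhs; split=> //; apply: open_ltfun => //; exact: cont_cst.
  apply: (@near_finite _ _ x (D `&` ~` [set` S]) (fun j => [set y | q j y < q i y])).
    by apply: sub_finite_set fN => j [].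
  move=> j [_ jS]; apply: open_nbhs_nbhs; split; first exact: open_ltfun.
  by apply: qj; exact/negP.
apply: filterS2 xN n1 => y Ny yS i Si; have [qi qj] := yS i Si; split=> // j jS.
have [->//|qj0] := eqVneq (q j y) 0.
by apply: qj; split; [split=> //; exists y|exact/negP].
Qed.

(** Two different sets of equal size each contain an index that the other lacks, and the two
    inequalities between these weights contradict each other. *)
Lemma layer_disjoint (S S' : {fset J}) (x : X) : #|` S| = #|` S'| -> layer S x -> layer S' x -> S = S'.
Proof.
move=> SS xS xS'; apply/eqP; rewrite eqEfcard SS leqnn andbT.
apply/fsubsetP => i iS; apply: contraT => iS'.
have : ~~ (S' `<=` S)%fset.
  apply/negP => S'S; have /eqP SE : S' == S by rewrite eqEfcard S'S SS leqnn.
  by rewrite SE iS in iS'.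
move=> /fsubsetPn[j jS' jS].
have [_ /(_ j jS) h] := xS i iS; have [_ /(_ i iS') h'] := xS' j jS'.
by have := lt_trans h h'; rewrite ltxx.
Qed.

(** Layers of equally large [S] are disjoint and hence form one family; [O s] collects those with
    [s.+1] indices. The support of the weights at [x] is a set whose layer contains [x]. *)
Lemma layers (w : J -> set X) : (forall j x, 0 < q j x -> w j x) ->
  exists O : nat -> set X, (forall s, dsm w (O s)) /\
  forall x, (exists j, q j x != 0) -> exists S : {fset J},
    [/\ forall j, j \in S -> 0 < q j x, (0 < #|` S|)%N & O #|` S|.-1 x].
Proof.
move=> qw; exists (fun s => \bigcup_(S in [set S | #|` S| = s.+1]) layer S); split.
  move=> s; apply: dsm_bigcup => [S /= Ss|S S' x /= Ss S's].
    have : (0 < #|` S|)%N by rewrite Ss.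
    rewrite cardfs_gt0 => /fset0Pn[i iS].
    apply: (@dsm_sub _ _ _ _ i (layer_open S)) => x /(_ i iS)[qi _]; exact: qw.
  by apply: layer_disjoint; rewrite Ss.
move=> x [j qj]; have [N xN fN] := lq x.
have fS : finite_set [set j | q j x != 0].
  apply: sub_finite_set fN => i /= qi; split=> //; exists x; split=> //.
  exact: nbhs_singleton.
pose S := fset_set [set j | q j x != 0].
have inS i : (i \in S) = (q i x != 0).
  by rewrite in_fset_set //; apply/idP/idP => [/set_mem|?]; [|exact: mem_set].
have S0 : (0 < #|` S|)%N by rewrite cardfs_gt0; apply/fset0Pn; exists j; rewrite inS.
exists S; split=> //; first by move=> i; rewrite inS => qi; rewrite lt_def qi q0.
exists S; first by rewrite /= prednK.
move=> i; rewrite inS => qi; have qi0 : 0 < q i x by rewrite lt_def qi q0.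
by split=> // k; rewrite inS negbK => /eqP ->.
Qed.

End Layers.

(** * Separation of pairs of closed sets in finite C-spaces *)

Section FiniteC.
Variables (X : topologicalType) (hX : paracompact X).

Lemma In_map (A B : Type) (f : A -> B) (s : seq A) b :
  List.In b (map f s) <-> exists2 a, List.In a s & f a = b.
Proof.
elim: s => [|a s IH] /=; first by split=> [|[]].
rewrite IH; split=> [[<-|[a' sa' <-]]|[a' [<-|sa'] <-]].
- by exists a; [left|].
- by exists a'; [right|].
- by left.
- by right; exists a'.
Qed.

Lemma In_mem (A : eqType) (s : seq A) a : List.In a s <-> a \in s.
Proof.
elim: s => [|b s IH] //=; rewrite inE IH; split.
- by move=> [->|->]; rewrite ?eqxx ?orbT.
- by move=> /orP[/eqP ->|]; [left|right].
Qed.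

Lemma sum1_ex (I : choiceType) (p : I -> RR) :
  \sum_(i \in [set: I]) p i = 1 -> exists i, p i != 0.
Proof.
move=> s1; apply: contrapT => ne; have := s1; rewrite fsbig1.
  by move/eqP; rewrite eq_sym oner_eq0.
by move=> i _; apply: contrapT => /eqP pi; apply: ne; exists i.
Qed.

(** The complements of the unions of [P i] and [Q i] are partitions between [E i] and [D i], and the
    first [k] of them have no common point in [A]. Demanded of all pairs, as in [handled], this is
    the Eilenberg-Otto form of dimension less than [k]. *)
Definition sep_cover k (A : set X) (E D : nat -> set X) :=
  exists P Q : nat -> set X, [/\ forall i, open (P i) /\ open (Q i),
    forall i, E i `<=` P i /\ D i `<=` Q i,
    forall i x, P i x -> Q i x -> False &
    forall x, A x -> exists2 i, (i < k)%N & P i x \/ Q i x].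

Definition handled k (A : set X) := forall E D : nat -> set X,
  (forall i, closed (E i) /\ closed (D i)) ->
  (forall i, E i `<=` A /\ D i `<=` A) ->
  (forall i x, E i x -> D i x -> False) -> sep_cover k A E D.

Lemma handledS k (A B : set X) : B `<=` A -> handled k A -> handled k B.
Proof.
move=> BA hA E D cED EDB dED.
have [|P [Q [oPQ sPQ dPQ cPQ]]] := hA E D cED _ dED.
  by move=> i; have [EB DB] := EDB i; split; exact: subset_trans BA.
by exists P, Q; split=> // x /BA; exact: cPQ.
Qed.

Section HC.
Hypothesis hC : finite_C_space X.

Lemma finite_C_open (U : nat -> nat -> set X) (N : nat -> nat) :
  (forall n i, open (U n i)) -> (forall n x, exists2 i, (i < N n)%N & U n i x) ->
  exists k (D : nat -> set X), (forall n, (n < k)%N -> dsm (U n) (D n)) /\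
    forall x, exists2 n, (n < k)%N & D n x.
Proof.
move=> oU cU.
pose O n i := if (i < N n)%N then U n i else set0.
have /choice[p pP] : forall n, exists p : nat -> X -> RR,
  [/\ forall i, continuous (p i), forall i x, 0 <= p i x,
    forall i, closure [set x | p i x != 0] `<=` O n i,
    lfin setT (fun i => [set x | p i x != 0]) &
    forall x, \sum_(i \in [set: nat]) p i x = 1].
  move=> n; apply: partition_of_unity => //.
    by move=> i; rewrite /O; case: ifP => // _; exact: open0.
  by move=> x; have [i iN Ui] := cU n x; exists i; rewrite /O iN.
pose cz n i := [set x | p n i x != 0].
have czO n i : cz n i `<=` O n i.
  by move=> x cx; have [_ _ + _ _] := pP n; apply; exact: subset_closure.
have [n|k [g [gP gc]]] := hC (w := fun n => [seq cz n i | i <- iota 0 (N n)]).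
  split.
    move=> S /In_map[i _ <-]; exists (p n i); split=> //.
    by have [+ _ _ _ _] := pP n; exact.
  move=> x; have [_ _ _ _ /(_ x)/sum1_ex[i pi]] := pP n.
  exists (cz n i) => //; apply/In_map; exists i => //; apply/In_mem.
  rewrite mem_iota add0n /=; have := czO n i x pi.
  by rewrite /O; case: ifP.
exists k, (fun n => \bigcup_(S in [set S | List.In S (g n)]) S); split.
  move=> n nk; have [fg dg rg] := gP n nk.
  apply: dsm_bigcup => [S /= Sg|S S' x /= Sg S'g Sx S'x].
    have [_ /In_map[i _ <-] Si] := rg S Sg; apply: (@dsm_sub _ _ _ _ i).
      by have [f [cf ->]] := fg S Sg; exact: open_neq0.
    by move=> x /Si /czO; rewrite /O; case: ifP.
  apply: contrapT => SS'; have := dg _ _ Sg S'g SS'.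
  by move=> SS0; have : (S `&` S') x by []; rewrite SS0.
by move=> x; have [n [nk [S Sg Sx]]] := gc x; exists n => //; exists S.
Qed.

(** Each pair gives the cover by the complements of [E n] and [D n]. The resulting pieces
    [g n true], which avoid [D n], and [g n false], which avoid [E n], are shrunk to closed sets
    [H n b] that still cover. *)
Lemma finite_C_pairs (E D : nat -> set X) :
  (forall i, closed (E i) /\ closed (D i)) ->
  (forall i x, E i x -> D i x -> False) -> exists k, sep_cover k setT E D.
Proof.
move=> cED dED.
pose U (n i : nat) := if i == 0%N then ~` E n else ~` D n.
pose W (n : nat) (b : bool) := if b then ~` D n else ~` E n.
have oW n b : open (W n b) by rewrite /W; have [? ?] := cED n; case: b; exact: closed_openC.
have oU n i : open (U n i) by rewrite /U; case: ifP => _; [exact: (oW n false)|exact: (oW n true)].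
have [|k [G [dG cG]]] := @finite_C_open U (fun=> 2%N) oU.
  move=> n x; have [Ex|nE] := pselect (E n x); last by exists 0%N.
  by exists 1%N => // Dx; exact: dED Ex Dx.
have /choice[g gP] : forall n, exists g : bool -> set X, (n < k)%N ->
    [/\ forall i, open (g i), forall i, g i `<=` W n i,
    forall i j x, g i x -> g j x -> i = j & forall x, G n x <-> exists i, g i x].
  move=> n; case: (ltnP n k) => nk; last by exists (fun=> set0).
  suff [g gP] : dsm (W n) (G n) by exists g.
  apply: dsm_trans (dG n nk) _ => i.
  by apply: (@dsm_sub _ _ _ _ (i != 0%N) (oU n i)); rewrite /U /W; case: eqP => _ x.
pose O (nb : nat * bool) := if (nb.1 < k)%N then g nb.1 nb.2 else set0.
have [||p [_ _ sp _ p1]] := @partition_of_unity X hX _ O.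
- move=> [n b]; rewrite /O /=; case: ifP => nk; last exact: open0.
  by have [+ _ _ _] := gP n nk; exact.
- move=> x; have [n nk Gx] := cG x; have [_ _ _ /(_ x)[/(_ Gx)[b gb] _]] := gP n nk.
  by exists (n, b); rewrite /O /= nk.
pose H n b := closure [set x | p (n, b) x != 0].
have HO n b x : H n b x -> (n < k)%N /\ g n b x.
  by move/(sp (n, b)); rewrite /O /=; case: ifP.
(* Normality swells [E n] with [H n true] and [D n] with [H n false] to disjoint open sets; [H n b]
   is empty for [n >= k]. *)
have : forall n, exists PQ : set X * set X, [/\ open PQ.1, open PQ.2,
    E n `|` H n true `<=` PQ.1, D n `|` H n false `<=` PQ.2 & PQ.1 `&` PQ.2 = set0].
  move=> n; have [cE cD] := cED n.
  have /(@normal_openP RR)/(_ (E n `|` H n true) (D n `|` H n false)) :=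
    paracompact_normal hX.
  case; [by apply: closedU => //; exact: closed_closure|
         by apply: closedU => //; exact: closed_closure| |]; last first.
    by move=> P [Q PQ]; exists (P, Q).
  apply/seteqP; split=> // x [[Ex|/HO[nk gt]] [Dx|/HO[nk' gf]]].
  + exact: dED Ex Dx.
  + by have [_ /(_ _ _ gf) + _ _] := gP n nk'; exact.
  + by have [_ /(_ _ _ gt) + _ _] := gP n nk; exact.
  + by have [_ _ /(_ _ _ _ gt gf)] := gP n nk.
move=> /choice[PQ PQP]; exists k, (fun n => (PQ n).1), (fun n => (PQ n).2); split.
- by move=> n; have [] := PQP n.
- by move=> n; have [_ _ EP DQ _] := PQP n; split=> x ?; [apply: EP|apply: DQ]; left.
- by move=> n x Px Qx; have [_ _ _ _ d] := PQP n; rewrite -[False]/(set0 x) -d.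
- move=> x _; have /sum1_ex[[n b] pn] := p1 x.
  have Hx : H n b x by exact: subset_closure.
  have [nk _] := HO _ _ _ Hx; exists n => //.
  have [_ _ EP DQ _] := PQP n.
  by case: b {pn} Hx => Hx; [left; apply: EP|right; apply: DQ]; right.
Qed.

Definition annulus (f : X -> RR) (j : nat) : set X :=
  [set x | j%:R <= f x /\ f x <= j.+1%:R].

Lemma annulus_closed f j : continuous f -> closed (annulus f j).
Proof.
by move=> cf; apply: closedI; apply: closed_lefun => //; exact: cont_cst.
Qed.

Lemma annulus_lfin (f : X -> RR) (I : Type) (P : set I) (h : I -> nat) (E : I -> set X) :
  continuous f -> (forall m, finite_set [set i | (h i < m)%N]) ->
  (forall i, P i -> E i `<=` annulus f (h i)) -> lfin P E.
Proof.
move=> cf fh Ef x; exists [set y | f y < f x + 1].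
  apply: open_nbhs_nbhs; split=> /=; last by rewrite ltrDl.
  by apply: open_ltfun => //; exact: cont_cst.
apply: sub_finite_set (fh (Num.bound `|f x + 1|)) => i [Pi [y [Ey /= fy]]].
have [hy _] := Ef i Pi y Ey.
rewrite -(ltr_nat RR); apply: le_lt_trans hy _; apply: lt_trans fy _.
exact: le_lt_trans (ler_norm _) (archi_boundP (normr_ge0 _)).
Qed.

(* Otherwise bad pairs on infinitely many far apart annuli would combine into a
   single sequence of pairs contradicting [finite_C_pairs]. *)
Lemma annuli_handled (f : X -> RR) : continuous f ->
  exists k, forall j, (k <= j)%N -> handled k (annulus f j).
Proof.
move=> cf; apply: contrapT => nk.
have /choice[g gP] : forall k, exists j, (k <= j)%N /\ ~ handled k (annulus f j).
  move=> k; apply: contrapT => nj; apply: nk; exists k => j kj.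
  by apply: contrapT => nh; apply: nj; exists j.
(* The jump by two leaves a gap: consecutive closed annuli would share a level set of [f]. *)
pose a := fix a n := if n is m.+1 then (g (a m)).+2 else 0%N.
have ga n : (a n <= g (a n))%N by have [] := gP (a n).
have an n : (n <= a n)%N.
  by elim: n => //= n IH; have := ga n; lia.
have gstep m d : ((g (a m)).+2 <= g (a (m + d.+1)))%N.
  elim: d => [|d IH]; first by rewrite addn1; exact: ga m.+1.
  apply: leq_trans IH _; rewrite !addnS -addnS; apply: leq_trans (ga _).
  by rewrite /= leqW // leqW // addnS.
have sep m n x : annulus f (g (a m)) x -> annulus f (g (a n)) x -> m = n.
  have H m' n' : (m' < n')%N -> annulus f (g (a m')) x -> annulus f (g (a n')) x -> False.
    move=> mn [_ h1] [h2 _]; have := gstep m' (n' - m'.+1)%N.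
    rewrite addnS -addSn subnKC // => h3.
    by have := le_trans h2 h1; rewrite ler_nat leqNgt h3.
  by move=> hm hn; case: (ltngtP m n) => // mn; [have := H _ _ mn hm hn|have := H _ _ mn hn hm].
have /choice[ED EDP] : forall n, exists ED : (nat -> set X) * (nat -> set X),
   [/\ forall i, closed (ED.1 i) /\ closed (ED.2 i),
  forall i, ED.1 i `<=` annulus f (g (a n)) /\ ED.2 i `<=` annulus f (g (a n)),
  forall i x, ED.1 i x -> ED.2 i x -> False &
  ~ sep_cover (a n) (annulus f (g (a n))) ED.1 ED.2].
  move=> n; apply: contrapT => nED; have [_] := gP (a n); apply=> E D cED sED dED.
  by apply: contrapT => ns; apply: nED; exists (E, D).
have fin m : finite_set [set n | (g (a n) < m)%N].
  apply: (@sub_finite_set _ _ `I_m); last exact: finite_II.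
  by move=> n /=; apply: leq_ltn_trans; exact: leq_trans (an n) (ga n).
have [||k [P [Q [oPQ sPQ dPQ cPQ]]]] := @finite_C_pairs
  (fun i => \bigcup_n (ED n).1 i) (fun i => \bigcup_n (ED n).2 i).
- move=> i; split; apply: lfin_bigcup_closed.
  + by apply: annulus_lfin cf fin _ => n _; have [_ /(_ i)[]] := EDP n.
  + by move=> n _; have [/(_ i)[]] := EDP n.
  + by apply: annulus_lfin cf fin _ => n _; have [_ /(_ i)[]] := EDP n.
  + by move=> n _; have [/(_ i)[]] := EDP n.
- move=> i x [m _ Ex] [n _ Dx].
  have mn : m = n.
    have [_ /(_ i)[h _] _ _] := EDP m; have [_ /(_ i)[_ h'] _ _] := EDP n.
    exact: sep (h _ Ex) (h' _ Dx).
  by subst n; have [_ _ /(_ i x Ex Dx)] := EDP m.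
(* The combined pairs are separated by their first [k] terms, and [k <= a k] contradicts the choice
   of the pairs on the annulus numbered [g (a k)]. *)
have [_ _ _] := EDP k; apply; exists P, Q; split=> //.
  by move=> i; have [EP DQ] := sPQ i; split=> x hx; [apply: EP|apply: DQ]; exists k.
by move=> x _; have [i ik PQx] := cPQ x I; exists i => //; exact: leq_trans ik (an k).
Qed.

End HC.
End FiniteC.

(** * From dimension bounds to disjoint refinements of infinite covers *)

Section Dimension.
Variables (X : topologicalType) (hX : paracompact X).

(** The complement of [A] is added to the cover under the index [N]; on [A] only the functions with
    index below [N] can be nonzero. *)
Lemma closed_cover_unity (A : set X) (U : nat -> set X) N : closed A ->
  (forall i, open (U i)) -> (forall x, A x -> exists2 i, (i < N)%N & U i x) ->
  exists p : nat -> X -> RR, [/\ forall i, continuous (p i), forall i x, 0 <= p i x,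
    lfin setT (fun i => [set x | p i x != 0]),
    forall i, A `&` closure [set x | p i x != 0] `<=` [set x | (i < N)%N /\ U i x] &
    (forall i x, (i < N)%N -> p i x != 0 -> U i x) /\
    forall x, A x -> exists i, p i x != 0].
Proof.
move=> cA oU cU.
pose O i := if (i < N)%N then U i else if i == N then ~` A else set0.
have [||p [cp p0 sp lp p1]] := @partition_of_unity X hX _ O.
- move=> i; rewrite /O; case: ifP => // _; case: ifP => _; [exact: closed_openC|exact: open0].
- move=> x; have [Ax|nA] := pselect (A x).
    by have [i iN Ui] := cU x Ax; exists i; rewrite /O iN.
  by exists N; rewrite /O ltnn eqxx.
exists p; split=> //; last split; last by move=> x _; exact: sum1_ex (p1 x).
  by move=> i x [Ax /sp]; rewrite /O; case: ifP => // _; case: ifP.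
by move=> i x iN px; have := sp i x; rewrite /O iN; apply; exact: subset_closure.
Qed.

(** The first [k] members listed in [s] shrink to their parts in [P j], all other members to their
    parts in the union of the [Q j]. A point common to all members of [s] would lie in every [P j]
    and in some [Q j]. Covering survives, since a point of [A] in [P j] is outside [Q j] and hence
    in [U (e j)]. *)
Lemma order_step k (A : set X) (U : nat -> set X) N (s : seq nat) :
  closed A -> handled k A -> (forall i, open (U i)) ->
  (forall x, A x -> exists2 i, (i < N)%N & U i x) ->
  uniq s -> size s = k.+1 -> {in s, forall i, (i < N)%N} ->
  exists U' : nat -> set X, [/\ forall i, open (U' i), forall i, U' i `<=` U i,
    forall x, A x -> exists2 i, (i < N)%N & U' i x &
    forall x, ~ {in s, forall i, U' i x}].
Proof.
move=> cA hA oU cU us ss sN.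
have [p [_ _ _ pU [_ pA]]] := closed_cover_unity cA oU cU.
pose F i := A `&` closure [set x | p i x != 0].
pose e j := nth 0%N s j.
have [|||P [Q [oPQ sPQ dPQ cPQ]]] := hA (fun j => F (e j)) (fun j => A `&` ~` U (e j)).
- move=> j; split; apply: closedI => //; [exact: closed_closure|exact: open_closedC].
- by move=> j; split=> x [].
- by move=> j x /pU[_ Ux] [].
pose U' i := if i \in take k s then U i `&` P (index i s)
             else U i `&` \bigcup_(j in [set j | (j < k)%N]) Q j.
have esk j : (j < k)%N -> e j \in take k s /\ index (e j) s = j.
  move=> jk; split; last by rewrite index_uniq // ss ltnW.
  rewrite /e -(nth_take 0%N jk) mem_nth // size_take ss ltnS leqnn //.
exists U'; split.
- move=> i; rewrite /U'; case: ifP => _; apply: openI => //.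
    by have [] := oPQ (index i s).
  by apply: bigcup_open => j _; have [] := oPQ j.
- by move=> i x; rewrite /U'; case: ifP => _ [].
- move=> x Ax; have [i pi] := pA x Ax.
  have Fi : F i x by split=> //; exact: subset_closure.
  have [iN Ui] := pU _ _ Fi.
  case: (boolP (i \in take k s)) => ik.
    exists i => //; rewrite /U' ik; split=> //.
    have [+ _] := sPQ (index i s); apply; rewrite /e nth_index //.
    exact: mem_take ik.
  have [j jk [Pj|Qj]] := cPQ x Ax; last first.
    by exists i => //; rewrite /U' (negbTE ik); split=> //; exists j.
  have [ek ij] := esk j jk.
  exists (e j); first by apply: sN; exact: mem_take ek.
  rewrite /U' ek ij; split=> //; apply: contrapT => nU.
  by apply: dPQ Pj _; have [_] := sPQ j; apply.
- move=> x sx.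
  have ek : e k \in s by rewrite mem_nth // ss.
  have ekn : e k \notin take k s.
    have := us; rewrite -{1}(cat_take_drop k s) cat_uniq => /and3P[_ /hasPn + _].
    apply; rewrite (drop_nth 0%N) ?ss // inE eqxx //.
  have := sx _ ek; rewrite /U' (negbTE ekn) => -[_ [j jk Qj]].
  have [ej ij] := esk j jk.
  have := sx _ (mem_take ej); rewrite /U' ej ij => -[_ Pj].
  exact: dPQ Pj Qj.
Qed.

(** [order_step] is applied in turn to every list of [k.+1] distinct indices below [N]; later
    shrinking keeps the earlier intersections empty. *)
Lemma order_shrink k (A : set X) (U : nat -> set X) N :
  closed A -> handled k A -> (forall i, open (U i)) ->
  (forall x, A x -> exists2 i, (i < N)%N & U i x) ->
  exists U' : nat -> set X, [/\ forall i, open (U' i), forall i, U' i `<=` U i,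
    forall x, A x -> exists2 i, (i < N)%N & U' i x &
    forall s x, uniq s -> size s = k.+1 -> {in s, forall i, (i < N)%N} ->
      ~ {in s, forall i, U' i x}].
Proof.
move=> cA hA oU cU.
suff H (ss : seq (seq nat)) : exists U' : nat -> set X,
    [/\ forall i, open (U' i), forall i, U' i `<=` U i,
    forall x, A x -> exists2 i, (i < N)%N & U' i x &
    forall s x, s \in ss -> uniq s -> size s = k.+1 -> {in s, forall i, (i < N)%N} ->
      ~ {in s, forall i, U' i x}].
  have [U' [oU' sU' cU' dU']] := H [seq map val (tval t) | t : k.+1.-tuple 'I_N].
  exists U'; split=> // s x us sk sN; apply: dU' => //.
  have sz : size (pmap insub s : seq 'I_N) == k.+1.
    rewrite size_pmap_sub -sk; apply/eqP; apply/eqP; rewrite -all_count; apply/allP => i.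
    exact: sN.
  apply/mapP; exists (Tuple sz); first by rewrite mem_enum.
  rewrite /= pmap_filter; last by move=> i; rewrite /= insubK.
  by apply/esym/all_filterP/allP => i iS; rewrite /= isSome_insub; exact: sN.
elim: ss => [|s ss [V [oV sV cV dV]]]; first by exists U; split=> // i x.
case: (pselect [/\ uniq s, size s = k.+1 & {in s, forall i, (i < N)%N}]) => [[us sk sN]|ns].
  have [W [oW sW cW dW]] := order_step cA hA oV cV us sk sN.
  exists W; split=> // [i x /sW /sV //|t x]; rewrite inE => /orP[/eqP ->|tS] ut tk tN.
    exact: dW.
  by move=> tW; apply: (dV t x) => // i /tW /sW.
exists V; split=> // t x; rewrite inE => /orP[/eqP -> us sk sN|]; last exact: dV.
by case: ns.
Qed.

Section Cover.
Variables (J : Type) (w : J -> set X).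

(** After shrinking, no point lies in more than [k] of the members numbered below [N], so on [A]
    only layers of at most [k] indices occur. *)
Lemma finite_dsm k (A : set X) (U : nat -> set X) N :
  closed A -> handled k A -> (forall i, dsm w (U i)) ->
  (forall x, A x -> exists2 i, (i < N)%N & U i x) ->
  exists D : nat -> set X, (forall n, dsm w (D n)) /\
    forall x, A x -> exists2 n, (n < k)%N & D n x.
Proof.
move=> cA hA dU cU.
have oU i : open (U i) by exact: dsm_open (dU i).
have [V [oV sV cV dV]] := order_shrink cA hA oU cU.
have [p [cp p0 lp pV [pU pA]]] := closed_cover_unity cA oV cV.
(* The weights from [N] on are cut off: the order bound and the inclusion [pU] concern indices below
   [N]. *)
pose q i x := if (i < N)%N then p i x else 0.
have [||||O [dO cO]] := @layers X nat q _ _ _ V.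
- by move=> i; rewrite /q; case: (i < N)%N => //; exact: cont_cst.
- by move=> i x; rewrite /q; case: ifP.
- by apply: lfinS lp => i _ x /=; rewrite /q; case: ifP; rewrite ?eqxx.
- move=> i x; rewrite /q; case: ifP; rewrite ?ltxx // => iN pi.
  by apply: pU => //; rewrite gt_eqF.
exists O; split.
  by move=> n; apply: dsm_trans (dO n) _ => i; exact: dsmS (dU i) (oV i) (sV i).
move=> x Ax; have [|S [qS S0 OS]] := cO x.
  have [i pi] := pA x Ax; exists i.
  have [|iN _] := pV i x; first by split=> //; exact: subset_closure.
  by rewrite /q iN.
exists #|` S|.-1 => //; rewrite prednK //; rewrite leqNgt; apply/negP => kS.
have ss : size (take k.+1 S) = k.+1 by rewrite size_takel.
apply: (dV (take k.+1 S) x) => //; first exact: take_uniq (fset_uniq S).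
  by move=> i /mem_take /qS; rewrite /q; case: ifP; rewrite ?ltxx.
move=> i /mem_take /qS; rewrite /q; case: ifP; rewrite ?ltxx // => iN pi.
by apply: pU => //; rewrite gt_eqF.
Qed.

End Cover.

(** The layers of a partition of unity, sorted by cardinality, replace an arbitrary cover by a
    countable one whose members each split disjointly. *)
Lemma countable_dsm (J : Type) (w : J -> set X) : (forall j, open (w j)) -> (forall x, exists j, w j x) ->
  exists O : nat -> set X, (forall s, dsm w (O s)) /\ forall x, exists s, O s x.
Proof.
elim/Pchoice: J => K in w *.
move=> ow cw; have [p [cp p0 sp lp p1]] := partition_of_unity hX ow cw.
have [|O [dO cO]] := layers cp p0 lp (w := w).
  by move=> j x pj; apply: sp; apply: subset_closure; rewrite /= gt_eqF.
exists O; split=> // x; have [|S [_ _ OS]] := cO x; last by exists #|` S|.-1.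
exact: sum1_ex (p1 x).
Qed.

(** [f] is the mean of the indices [s] under the weights [p s x]. If no [O s] with [s < j] contains
    [x], all the weight sits on indices at least [j], and so [f x >= j]. *)
Lemma exhaustion (O : nat -> set X) : (forall s, open (O s)) ->
  (forall x, exists s, O s x) ->
  exists f : X -> RR, [/\ continuous f, forall x, 0 <= f x &
    forall j x, f x < j%:R -> exists2 s, (s < j)%N & O s x].
Proof.
move=> oO cO; have [p [cp p0 sp lp p1]] := partition_of_unity hX oO cO.
exists (fun x => \sum_(s \in [set: nat]) s%:R * p s x); split.
- apply: (@lfin_sum_cont X nat RR^o (fun s x => s%:R * p s x)).
    by apply: lfinS lp => s _ x /=; rewrite mulf_eq0 negb_or => /andP[].
  by move=> s; apply: rcontM => //; exact: cont_cst.
- by move=> x; apply: fsumr_ge0 => s _; rewrite mulr_ge0.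
- move=> j x fj; apply: contrapT => nO.
  have pj s : (s < j)%N -> p s x = 0.
    move=> sj; apply: contrapT => /eqP ps; apply: nO; exists s => //.
    by apply: sp; exact: subset_closure.
  have [N xN fN] := lp x.
  pose A := fset_set [set i | setT i /\ [set x | p i x != 0] `&` N !=set0].
  have pA i : i \notin A -> p i x = 0.
    rewrite in_fset_set // notin_setE /= => nA.
    apply: contrapT => /eqP Fi; apply: nA; split=> //; exists x; split=> //.
    exact: nbhs_singleton.
  have := fj; rewrite (fsbigTE A); last by move=> i /pA ->; rewrite mulr0.
  rewrite ltNge => /negP; apply.
  have := p1 x; rewrite (fsbigTE A) // => s1.
  have -> : j%:R = j%:R * \sum_(i <- A) p i x by rewrite s1 mulr1.
  rewrite mulr_sumr; apply: ler_sum => s _.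
  case: (ltnP s j) => sj; first by rewrite pj // !mulr0.
  by apply: ler_wpM2r => //; rewrite ler_nat.
Qed.

(** Open neighbourhoods of the annuli. Those of equal parity are disjoint, as [j + 5/4] stays below
    [j + 2 - 1/4]. *)
Definition collar (f : X -> RR) (j : nat) : set X :=
  [set x | j%:R - 4^-1 < f x /\ f x < j%:R + 5 / 4].

Lemma collar_open f j : continuous f -> open (collar f j).
Proof.
by move=> cf; apply: openI; apply: open_ltfun => //; exact: cont_cst.
Qed.

Lemma annulus_collar f j : annulus f j `<=` collar f j.
Proof. by move=> x [h1]; rewrite -natr1 => h2; split; lra. Qed.

Lemma collar_disjoint (f : X -> RR) i j x : odd i = odd j -> collar f i x -> collar f j x -> i = j.
Proof.
have H i' j' : odd i' = odd j' -> (i' < j')%N -> collar f i' x -> collar f j' x -> False.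
  move=> ij lij [_ h1] [h2 _].
  have : (i'.+2 <= j')%N.
    rewrite ltn_neqAle lij andbT; apply/eqP => ji.
    by move: ij; rewrite -ji /=; case: (odd i').
  rewrite -(ler_nat RR) -addn2 natrD => h3; lra.
by move=> ij ci cj; case: (ltngtP i j) => // lij;
  [have := H _ _ ij lij ci cj|have := H _ _ (esym ij) lij cj ci].
Qed.

Lemma annulus_truncn (f : X -> RR) (x : X) : 0 <= f x -> annulus f (Num.truncn (f x)) x.
Proof. by move=> /truncn_itv/andP[h1 /ltW h2]. Qed.

(** On each annulus of an exhaustion finitely many members suffice, so [k] families cover its part
    of [A]. Collars let the even annuli share [k] families and the odd ones another [k]. *)
Lemma handled_dsm (J : Type) (w : J -> set X) k (A : set X) :
  closed A -> handled k A ->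
  (forall j, open (w j)) -> (forall x, exists j, w j x) ->
  exists D : nat -> set X, (forall n, dsm w (D n)) /\
    forall x, A x -> exists2 n, (n < k + k)%N & D n x.
Proof.
move=> cA hA ow cw; have [ O [dO cO]] := countable_dsm ow cw.
have [f [cf f0 fO]] := exhaustion (fun s => dsm_open (dO s)) cO.
have /choice[D DP] : forall j, exists D : nat -> set X, (forall n, dsm w (D n)) /\
    forall x, (A `&` annulus f j) x -> exists2 n, (n < k)%N & D n x.
  (* On the annulus [f] is at most [j.+1], hence below [j.+2], so the first [j.+2] sets cover it. *)
  move=> j; apply: (@finite_dsm _ w k (A `&` annulus f j) O j.+2) => //.
  - by apply: closedI => //; exact: annulus_closed.
  - by apply: handledS hA => x [].
  - by move=> x [_ [_ h]]; apply: fO; apply: le_lt_trans h _; rewrite ltr_nat.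
pose G (b : bool) n := \bigcup_(j in [set j | odd j = b]) (D j n `&` collar f j).
have dG b n : dsm w (G b n).
  apply: dsm_bigcup => [j _|i j x /= oi oj [_ ci] [_ cj]].
    have [dD _] := DP j; apply: dsmS (dD n) _ _; last by move=> x [].
    by apply: openI; [exact: dsm_open (dD n)|exact: collar_open].
  by apply: collar_disjoint ci cj; rewrite oi oj.
exists (fun n => if (n < k)%N then G false n else G true (n - k)%N); split.
  by move=> n; case: ifP => _.
move=> x Ax; have ax := annulus_truncn (f0 x).
set j := Num.truncn _ in ax; have [_ /(_ x (conj Ax ax))[n nk Dn]] := DP j.
have Gx : G (odd j) n x by exists j => //; split=> //; exact: annulus_collar.
case: (odd j) Gx => Gx.
  by exists (k + n)%N; rewrite ?ltn_add2l // ltnNge leq_addr /= addKn.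
by exists n; rewrite ?nk // ltn_addr.
Qed.

(** Separations found on the single annuli are cut down to the disjoint collars and united. *)
Lemma annuli_union_handled (f : X -> RR) k (P : set nat) : continuous f ->
  (forall i j, P i -> P j -> odd i = odd j) ->
  (forall j, P j -> handled k (annulus f j)) ->
  closed (\bigcup_(j in P) annulus f j) /\ handled k (\bigcup_(j in P) annulus f j).
Proof.
move=> cf oP hP; split.
  apply: lfin_bigcup_closed; last by move=> j _; exact: annulus_closed.
  by apply: (@annulus_lfin _ f _ _ id) => [//|m|i _ x//]; exact: finite_II.
move=> E D cED sED dED.
have /choice[PQ PQP] : forall j, exists PQ : (nat -> set X) * (nat -> set X), P j ->
   [/\ forall i, open (PQ.1 i) /\ open (PQ.2 i),
    forall i, E i `&` annulus f j `<=` PQ.1 i /\ D i `&` annulus f j `<=` PQ.2 i,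
    forall i x, PQ.1 i x -> PQ.2 i x -> False &
    forall x, annulus f j x -> exists2 i, (i < k)%N & PQ.1 i x \/ PQ.2 i x].
  move=> j; have [Pj|nP] := pselect (P j); last by exists (fun=> set0, fun=> set0).
  have [|||A [B AB]] := hP j Pj (fun i => E i `&` annulus f j) (fun i => D i `&` annulus f j).
  - by move=> i; have [? ?] := cED i; split; apply: closedI => //; exact: annulus_closed.
  - by move=> i; split=> x [].
  - by move=> i x [Ex _] [Dx _]; exact: dED Ex Dx.
  - by exists (A, B).
exists (fun i => \bigcup_(j in P) ((PQ j).1 i `&` collar f j)),
       (fun i => \bigcup_(j in P) ((PQ j).2 i `&` collar f j)); split.
- move=> i; split; apply: bigcup_open => j Pj; have [/(_ i)[? ?] _ _ _] := PQP j Pj;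
    by apply: openI => //; exact: collar_open.
- move=> i; have [EP DP] := sED i; split=> x hx.
    have [j Pj aj] := EP x hx; exists j => //; split; last exact: annulus_collar.
    by have [_ /(_ i)[h _] _ _] := PQP j Pj; apply: h.
  have [j Pj aj] := DP x hx; exists j => //; split; last exact: annulus_collar.
  by have [_ /(_ i)[_ h] _ _] := PQP j Pj; apply: h.
- move=> i x [j Pj [Pj1 cj]] [j' Pj' [Pj2 cj']].
  have jj : j = j' by apply: collar_disjoint cj cj'; exact: oP.
  by subst j'; have [_ _ + _] := PQP j Pj; apply; eassumption.
- move=> x [j Pj aj]; have [_ _ _ /(_ x aj)[i ik h]] := PQP j Pj.
  by exists i => //; case: h => h; [left|right]; exists j => //; split=> //; exact: annulus_collar.
Qed.

Section Universal.
Variable I : Type.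

(** The number [k] is fixed before the covers, so the property can be applied to any tail of a
    sequence of covers. *)
Definition ucov k (A : set X) := forall V : nat -> I -> set X,
  (forall n i, open (V n i)) -> (forall n x, exists i, V n i x) ->
  exists D : nat -> set X, (forall n, (n < k)%N -> dsm (V n) (D n)) /\
    forall x, A x -> exists2 n, (n < k)%N & D n x.

(** All [k + k] families come from one cover, the common refinement of the first [k + k] covers,
    indexed by choices of a member from each. *)
Lemma ucov_handled k A : closed A -> handled k A -> ucov (k + k) A.
Proof.
move=> cA hA V oV cV.
pose w (j : nat -> I) := [set x | forall n, `I_(k + k) n -> V n (j n) x].
have ow j : open (w j).
  rewrite openE => x wx; apply: near_finite; first exact: finite_II.
  by move=> n nk; apply: open_nbhs_nbhs; split=> //; exact: wx.
have [|D [dD cD]] := @handled_dsm _ w k A cA hA ow.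
  by move=> x; have /choice[j jP] := fun n => cV n x; exists j => n _; exact: jP.
exists D; split=> // n nk; apply: dsm_cover ow _ (dD n).
by move=> j; exists (j n) => x; exact.
Qed.

Lemma ucovU a b A B : ucov a A -> ucov b B -> ucov (a + b) (A `|` B).
Proof.
move=> hA hB V oV cV; have [D [dD cD]] := hA V oV cV.
have [E [dE cE]] := hB (fun n => V (a + n)%N) (fun n => oV _) (fun n => cV _).
exists (fun n => if (n < a)%N then D n else E (n - a)%N); split.
  move=> n nab; case: ltnP => na; first exact: dD.
  by have := dE (n - a)%N; rewrite subnKC //; apply; rewrite ltn_subLR.
move=> x [/cD[n na Dn]|/cE[n nb En]].
  by exists n; rewrite ?na // ltn_addr.
by exists (a + n)%N; rewrite ?ltn_add2l // ltnNge leq_addr /= addKn.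
Qed.

Lemma ucovS a A B : B `<=` A -> ucov a A -> ucov a B.
Proof.
move=> BA hA V oV cV; have [D [dD cD]] := hA V oV cV; exists D; split=> // x /BA.
exact: cD.
Qed.

Lemma ucov_bigcup (A : nat -> set X) K : (forall n, exists k, ucov k (A n)) ->
  exists k, ucov k (\bigcup_(n in `I_K) A n).
Proof.
move=> hA; elim: K => [|K [k hk]].
  exists 0%N => V oV cV; exists (fun=> set0); split=> // x [].
  by [].
have [l hl] := hA K; exists (k + l)%N; apply: ucovS (ucovU hk hl).
move=> x [n /= nK An]; have [nK'|/eqP nK'] := eqVneq n K; first by right; rewrite -nK'.
by left; exists n => //=; move: nK; rewrite ltnS leq_eqVlt => /orP[/eqP|].
Qed.

(** Each infinite cover is reduced to a finite one by lumping together the region where its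
    exhaustion is large. The finite C property handles the rest with [K] families, and the [K]
    lumped regions have a common bound [c] for further families. *)
Lemma finite_C_disjoint_refinement (V : nat -> I -> set X) : finite_C_space X ->
  (forall n i, open (V n i)) -> (forall n x, exists i, V n i x) ->
  exists k (D : nat -> set X), (forall n, (n < k)%N -> dsm (V n) (D n)) /\
    forall x, exists2 n, (n < k)%N & D n x.
Proof.
move=> hC oV cV.
have /choice[ O OP] : forall n, exists O : nat -> set X,
    (forall s, dsm (V n) (O s)) /\ forall x, exists s, O s x.
  by move=> n; exact: countable_dsm (oV n) (cV n).
have oO n s : open (O n s) by have [/(_ s) + _] := OP n; exact: dsm_open.
have /choice[f fP] : forall n, exists f : X -> RR, [/\ continuous f, forall x, 0 <= f x &
    forall j x, f x < j%:R -> exists2 s, (s < j)%N & O n s x].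
  by move=> n; have [_ cO] := OP n; exact: exhaustion (oO n) cO.
have /choice[k kP] : forall n, exists k, forall j, (k <= j)%N -> handled k (annulus (f n) j).
  by move=> n; have [cf _ _] := fP n; exact (@annuli_handled X hX hC (f n) cf).
pose B n := [set x | (k n)%:R <= f n x].
have uB n : exists c, ucov c (B n).
  have [cf f0 _] := fP n.
  pose P b := [set j | (k n <= j)%N /\ odd j = b].
  have [||cF hF] := @annuli_union_handled (f n) (k n) (P false) cf.
  - by move=> i j [_ ->] [_ ->].
  - by move=> j [kj _]; exact: kP.
  have [||cT hT] := @annuli_union_handled (f n) (k n) (P true) cf.
  - by move=> i j [_ ->] [_ ->].
  - by move=> j [kj _]; exact: kP.
  eexists; apply: ucovS (ucovU (ucov_handled cF hF) (ucov_handled cT hT)).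
  move=> x /= kx; have ax := annulus_truncn (f0 x); set j := Num.truncn _ in ax.
  have kj : (k n <= j)%N by rewrite truncn_ge_nat.
  by case oj : (odd j); [right|left]; exists j.
(* The part [f n <= k n] is covered by the first [(k n).+1] sets; the remaining region is the one
   additional member, numbered [(k n).+1]. *)
pose U n i := if (i < (k n).+1)%N then O n i
              else if i == (k n).+1 then [set x | (k n)%:R < f n x] else set0.
have [||K [G [dG cG]]] := @finite_C_open X hX hC U (fun n => (k n).+2).
- move=> n i; rewrite /U; case: ifP => // _; case: ifP => _; last exact: open0.
  by have [cf _ _] := fP n; apply: open_ltfun => //; exact: cont_cst.
- move=> n x; have [cf f0 fO] := fP n.
  case: (leP (f n x) (k n)%:R) => h; last first.
    by exists (k n).+1; rewrite /U ?ltnn ?eqxx.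
  have [|s sk Os] := fO (k n).+1 x; first by apply: le_lt_trans h _; rewrite ltr_nat.
  by exists s; [exact: leqW|rewrite /U sk].
(* As [c] is independent of the covers, it may be used for those from [V K] onwards, although [K]
   was found only now. *)
have [c uc] := ucov_bigcup K uB.
have [D [dD cD]] := uc (fun n => V (K + n)%N) (fun n => oV _) (fun n => cV _).
have /choice[G' G'P] : forall n, exists G' : set X, (n < K)%N ->
    dsm (V n) G' /\ forall x, G n x -> G' x \/ B n x.
  move=> n; case: (ltnP n K) => nK; last by exists set0.
  have [g [og gU dg Gg]] := dG n nK.
  exists (\bigcup_(i in [set i | (i < (k n).+1)%N]) g i) => _; split.
    apply: dsm_bigcup => [i /= ik|i j x _ _]; last exact: dg.
    have [dO _] := OP n; apply: dsmS (dO i) (og i) _.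
    by have := gU i; rewrite /U ik.
  move=> x /Gg[i gi]; case: (ltnP i (k n).+1) => ik; first by left; exists i.
  right; have := gU i x gi; rewrite /U ltnNge ik /=; case: ifP => // _.
  exact: ltW.
exists (K + c)%N, (fun n => if (n < K)%N then G' n else D (n - K)%N); split.
  move=> n nKc; case: ltnP => nK; first by have [] := G'P n nK.
  by have := dD (n - K)%N; rewrite subnKC //; apply; rewrite ltn_subLR.
move=> x; have [n nK Gx] := cG x; have [_ /(_ x Gx)[G'x|Bx]] := G'P n nK.
  by exists n; rewrite ?nK // ltn_addr.
have [|m mc Dm] := cD x; first by exists n.
by exists (K + m)%N; rewrite ?ltn_add2l // ltnNge leq_addr /= addKn.
Qed.

End Universal.
End Dimension.

(** * Parametrized selections *)

Section BarycentricCoordinates.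

(** One space for the barycentric coordinates of simplices of all dimensions, so that passing to a
    face does not change the type. *)
Definition par : topologicalType := prod_topology (fun _ : nat => RR).

Lemma par_coord i : continuous (fun t : par => t i).
Proof. by move=> t; apply: (@proj_continuous nat (fun=> RR) i t). Qed.

Lemma par_cont (Z : topologicalType) (F : Z -> par) :
  (forall i, continuous (fun z => F z i)) -> continuous F.
Proof.
move=> cF z; apply/cvg_sup => i A [B [[C oC <-] Cz] sBA].
by apply: filterS sBA _; apply: cF; exact: open_nbhs_nbhs.
Qed.

Lemma pair_cont (Z U V : topologicalType) (f : Z -> U) (g : Z -> V) :
  continuous f -> continuous g -> continuous (fun z => (f z, g z)).
Proof. by move=> cf cg z; apply: cvg_pair; [exact: cf|exact: cg]. Qed.

Lemma fst_cont (U V : topologicalType) : continuous (fun p : U * V => p.1).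
Proof. by move=> p; exact: cvg_fst. Qed.

Lemma snd_cont (U V : topologicalType) : continuous (fun p : U * V => p.2).
Proof. by move=> p; exact: cvg_snd. Qed.

Lemma comp_cont (U V W : topologicalType) (f : U -> V) (g : V -> W) :
  continuous f -> continuous g -> continuous (fun x => g (f x)).
Proof. by move=> cf cg x; apply: continuous_comp; [exact: cf|exact: cg]. Qed.

Lemma cube_compact n : compact (cube n).
Proof.
have -> : cube n = [set v : 'rV[RR]_n | forall i, `[(0 : RR), 1]%classic (v ord0 i)].
  by apply/seteqP; split=> v h i; have := h i; rewrite /= in_itv.
apply: (@rV_compact _ n (fun=> `[(0 : RR), 1]%classic)) => _.
exact: (@segment_compact RR).
Qed.

Definition clamp n (v : 'rV[RR]_n) : 'rV[RR]_n :=
  \row_j Num.max 0 (Num.min 1 (v ord0 j)).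

Lemma row_cont (Z : topologicalType) n (F : Z -> 'I_n -> RR) :
  (forall j, continuous (F^~ j)) -> continuous (fun z => \row_j F z j : 'rV[RR]_n).
Proof.
move=> cF z A [P nP sPA].
have : nbhs z [set y | forall j : 'I_n, setT j -> P ord0 j (F y j)].
  apply: near_finite => [|j _]; first exact: finite_finset.
  by apply: cF; have := nP ord0 j; rewrite mxE.
by apply: filterS => y Py; apply: sPA => i j; rewrite !ord1 mxE; exact: Py.
Qed.

Lemma clamp_cont n : continuous (@clamp n).
Proof.
apply: row_cont => j; apply: rcont_max; first exact: cont_cst.
by apply: rcont_min; [exact: cont_cst|exact: coord_continuous].
Qed.

Lemma clamp_cube n v : cube n (clamp v).
Proof.
move=> i; rewrite mxE; apply/andP; split; first by rewrite le_max lexx.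
by rewrite ge_max ler01 ge_min lexx.
Qed.

Lemma clamp_id n v : cube n v -> clamp v = v.
Proof.
move=> cv; apply/rowP => j; rewrite mxE; have /andP[h1 h2] := cv j.
by rewrite (min_idPr h2) (max_idPr h1).
Qed.

(** [clamp] retracts the whole space onto the cube, so a map continuous on the cube yields an
    everywhere continuous one with the same values there. *)
Lemma clamp_comp_cont (Y : topologicalType) n (h : 'rV[RR]_n -> Y) :
  {within cube n, continuous h} -> continuous (fun v => h (clamp v)).
Proof.
move=> ch v A hA.
have : @nbhs_subspace _ (cube n) (clamp v) (h @^-1` A) by exact: ch hA.
rewrite -(nbhs_subspace_in (@clamp_cube n v)) => nA.
have : nbhs v [set v' | cube n (clamp v') -> A (h (clamp v'))].
  exact: (clamp_cont nA).
by apply: filterS => v'; apply; exact: clamp_cube.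
Qed.

(** A point of the cube supplies the coordinates from [1] on; coordinate [0] receives what they lack
    to sum [1], or zero if their sum exceeds it. *)
Definition iota_par n (s : 'rV[RR]_n) : par := fun i =>
  if i == 0%N then Num.max 0 (1 - \sum_(j < n) s ord0 j)
  else oapp (fun j => s ord0 j) 0 (insub i.-1).

Lemma iota_par_cont n : continuous (@iota_par n).
Proof.
apply: par_cont => i; rewrite /iota_par; case: eqP => _.
  apply: rcont_max; first exact: cont_cst.
  apply: rcontB; first exact: cont_cst.
  by apply: rcont_sum => j; exact: coord_continuous.
case: insub => [j|] /=; [exact: coord_continuous|exact: cont_cst].
Qed.

Definition pi_par n (t : par) : 'rV[RR]_n := \row_j t j.+1.

Lemma pi_par_cont n : continuous (@pi_par n).
Proof. by apply: row_cont => j; exact: par_coord. Qed.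

(* The simplex with barycentric coordinates [t 0, ..., t n], slightly enlarged
   so that it is the image of the whole cube. *)
Definition simplex n : set par := [set t |
  [/\ forall i, (n < i)%N -> t i = 0, forall i, (0 < i <= n)%N -> 0 <= t i <= 1 &
  t 0%N = Num.max 0 (1 - \sum_(j < n) t j.+1)]].

Lemma iota_simplex n s : cube n s -> simplex n (iota_par s).
Proof.
move=> cs; rewrite /iota_par; split.
- by move=> [|i] //= ni; rewrite insubF //; apply/negbTE; rewrite -leqNgt.
- by move=> [|i] //= ni; rewrite insubT /=; exact: cs.
- rewrite /=; congr (Num.max 0 (1 - _)); apply: eq_bigr => j _.
  by rewrite valK.
Qed.

Lemma pi_simplex n t : simplex n t -> cube n (pi_par n t) /\ iota_par (pi_par n t) = t.
Proof.
move=> [t0 t1 t2]; split; first by move=> i; rewrite mxE; apply: t1; rewrite /= ltn_ord.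
apply/funext => -[|i]; rewrite /iota_par /=.
  by rewrite t2; congr (Num.max 0 (1 - _)); apply: eq_bigr => j _; rewrite mxE.
case: insubP => [j _ <-|]; first by rewrite /= mxE.
by rewrite -leqNgt => ni /=; rewrite t0.
Qed.

Lemma simplex_face n t : simplex n t -> t n = 0 -> exists2 m, n = m.+1 & simplex m t.
Proof.
case: n => [|n] [t0 t1 t2] tn.
  (* In dimension [0] the only coordinate is [1], so it cannot vanish. *)
  move: t2; rewrite big_ord0 subr0 tn => h.
  by have := ltr01 (R := RR); rewrite [X in _ < X](_ : 1 = 0) ?ltxx // h max_r.
exists n => //; split.
- by move=> i; rewrite leq_eqVlt => /orP[/eqP <- //|]; exact: t0.
- by move=> i /andP[i0 ni]; apply: t1; rewrite i0 leqW.
- by rewrite t2 big_ord_recr /= tn addr0.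
Qed.

End BarycentricCoordinates.

(** * Compactness and uniform approximation *)

Section CompactApproximation.
Variable Y : completeNormedModType RR.

(** The image of a compact set under [g] has positive distance from a disjoint closed set, obtained
    by a covering argument with [d] tending to zero from the right. *)
Lemma compact_avoid (Z : topologicalType) (K : set Z) (g : Z -> Y) (C : set Y) :
  compact K -> continuous g -> closed C -> (forall s, K s -> ~ C (g s)) ->
  exists2 d : RR, 0 < d & forall s z, K s -> `|g s - z| < d -> ~ C z.
Proof.
move=> /compact_near_coveringP cK cg cC gC.
have := cK _ (0^'+) (fun d s => forall z, `|g s - z| < d -> ~ C z) _.
case=> [s Ks|d0 /= d0p dP]; last first.
  exists (d0 / 2) => [|s z Ks]; first by rewrite divr_gt0.
  apply: (dP (d0 / 2)) Ks z; last by rewrite divr_gt0.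
  by rewrite /= sub0r normrN gtr0_norm ?divr_gt0 // ltr_pdivrMr // ltr_pMr // ltr1n.
have /nbhs_ballP[e /= e0 eC] : nbhs (g s) (~` C).
  by apply: open_nbhs_nbhs; split; [exact: closed_openC|exact: gC].
exists ([set s' | `|g s - g s'| < e / 2], [set d | 0 < d -> d < e / 2]) => /=.
  split; first by have /cvgrPdist_lt := cg s; apply; rewrite divr_gt0.
  exists (e / 2) => /=; first by rewrite divr_gt0.
  by move=> d /=; rewrite sub0r normrN => h d0 _; rewrite gtr0_norm in h.
move=> [s' d] /= [gs hd] z zd; apply: eC; rewrite -ball_normE /=.
have := ler_distD (g s') (g s) z.
have [d0|d0] := ltP 0 d; first by have := hd d0; lra.
by have := normr_ge0 (g s' - z); lra.
Qed.

Lemma compact_net n (K : set 'rV[RR]_n) (g : 'rV[RR]_n -> Y) (e : RR) :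
  compact K -> continuous g -> 0 < e ->
  exists r : seq 'rV[RR]_n, (forall s, s \in r -> K s) /\
    forall s, K s -> exists2 s0, s0 \in r & `|g s0 - g s| < e.
Proof.
move=> cK cg e0; rewrite compact_cover in cK.
have [||D sD cD] := cK _ K (fun s0 => [set s | `|g s0 - g s| < e]).
- move=> s0 _; apply: open_ltfun; last exact: cont_cst.
  by apply: cont_norm; apply: contB => //; exact: cont_cst.
- by move=> s Ks; exists s => //=; rewrite subrr normr0.
exists D; split; first by move=> s /sD /set_mem.
by move=> s /cD[s0 /= s0D gs]; exists s0.
Qed.

(* Small closed pieces of the cube turn density in the compact-open topology
   into uniform approximation. *)
Lemma Zn_uniform n (A F : set Y) (g : 'rV[RR]_n -> Y) (d : RR) :
  Zn_set_in n A F -> continuous g -> (forall s, cube n s -> A (g s)) -> 0 < d ->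
  exists h : 'rV[RR]_n -> Y, [/\ continuous h, forall s, (A `\` F) (h s) &
    forall s, cube n s -> `|h s - g s| < d].
Proof.
move=> [_ [_ dense]] cg gA d0.
have e0 : 0 < d / 3 by rewrite divr_gt0.
have [r [rK rc]] := compact_net (@cube_compact n) cg e0.
(* On a piece [g] varies by at most [d / 3] from its centre value and [h] by less than [d / 2],
   which together stay below [d]. *)
pose pc s0 := (cube n `&` [set s | `|g s0 - g s| <= d / 3],
               [set y | `|g s0 - y| < d / 2]).
have cgw : cont_cube_map n A g.
  by split; [exact: continuous_subspaceT|move=> _ [s cs <-]; exact: gA].
have [p /In_map[s0 /In_mem s0r <-]|h [[ch hA] hp]] := dense g cgw (map pc r).
  split=> /=.
  - apply: (subclosed_compact _ (@cube_compact n)); last by move=> s [].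
    apply: closedI; first exact: compact_closed (@norm_hausdorff _ _) (@cube_compact n).
    apply: closed_lefun; last exact: cont_cst.
    by apply: cont_norm; apply: contB => //; exact: cont_cst.
  - by move=> s [].
  - have := @ball_open _ Y (g s0) (d / 2); rewrite -ball_normE; apply.
  - by move=> _ [s [_ /= h] <-] /=; apply: le_lt_trans h _; lra.
exists (fun s => h (clamp s)); split.
- exact: clamp_comp_cont.
- by move=> s; apply: hA; exists (clamp s) => //; exact: clamp_cube.
- move=> s cs; rewrite clamp_id //; have [s0 s0r gs] := rc s cs.
  have /= hs : `|g s0 - h s| < d / 2.
    apply: (hp (pc s0)); first by apply/In_map; exists s0 => //; exact/In_mem.
    by exists s => //; split=> //=; exact: ltW.
  have := ler_distD (g s0) (h s) (g s); rewrite (distrC (h s) (g s0)); lra.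
Qed.

End CompactApproximation.

(** * Gluing and perturbing parametrized selections *)

Section ParametrizedSelections.
Variables (X : topologicalType) (hX : paracompact X).
Variables (Y : completeNormedModType RR) (phi : X -> set Y).
Hypotheses (phic : forall x, closed_convex_nonempty (phi x)) (phil : lsc_setmap phi).

Let phi_convex x : convex_subset (phi x).
Proof. by have [_ []] := phic x. Qed.

Definition selmap (u : X -> par -> Y) :=
  continuous (fun p : X * par => u p.1 p.2) /\ forall x t, phi x (u x t).

Definition blend (u1 u2 : X -> par -> Y) (m : par -> RR) x t :=
  u1 x t + m t *: (u2 x t - u1 x t).

Lemma blend_in (u1 u2 : X -> par -> Y) m x t : 0 <= m t -> m t <= 1 ->
  phi x (u1 x t) -> phi x (u2 x t) -> phi x (blend u1 u2 m x t).
Proof.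
move=> m0 m1 p1 p2; have := phi_convex p2 p1 m0 m1.
by rewrite /blend scalerBr scalerBl scale1r addrCA.
Qed.

(** The sets on which [u1] and [u2] are to be kept are given as zero sets of [a1] and [a2]. The
    quotient [m] interpolates between the two maps. *)
Lemma glue2 (u1 u2 : X -> par -> Y) (a1 a2 : par -> RR) :
  selmap u1 -> selmap u2 -> continuous a1 -> continuous a2 ->
  (forall t, 0 <= a1 t) -> (forall t, 0 <= a2 t) ->
  (forall x t, a1 t = 0 -> a2 t = 0 -> u1 x t = u2 x t) ->
  exists u, [/\ selmap u, forall x t, a1 t = 0 -> u x t = u1 x t &
    forall x t, a2 t = 0 -> u x t = u2 x t].
Proof.
move=> [c1 s1] [c2 s2] ca1 ca2 p1 p2 agree.
pose m t := a1 t / (a1 t + a2 t).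
have m0 t : 0 <= m t by rewrite divr_ge0 // addr_ge0.
have m1 t : m t <= 1.
  rewrite /m; have [->|d0] := eqVneq (a1 t + a2 t) 0; first by rewrite invr0 mulr0.
  by rewrite ler_pdivrMr ?mul1r ?lerDl // lt_def d0 addr_ge0.
exists (blend u1 u2 m); split; first split.
(* At a common zero of [a1] and [a2] the weight [m] may be discontinuous, but it is bounded by [1]
   and multiplies a difference that tends to zero. *)
- move=> p0; have [d0|d0] := eqVneq (a1 p0.2 + a2 p0.2) 0.
    have /eqP := d0; rewrite paddr_eq0 // => /andP[/eqP a10 /eqP a20].
    have e12 := agree p0.1 p0.2 a10 a20.
    have e0 : blend u1 u2 m p0.1 p0.2 = u1 p0.1 p0.2.
      by rewrite /blend e12 subrr scaler0 addr0.
    apply/cvgrPdist_lt => e ep; rewrite e0.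
    have e4 : 0 < e / 4 by rewrite divr_gt0.
    have /cvgrPdist_lt/(_ _ e4) h1 := c1 p0.
    have /cvgrPdist_lt/(_ _ e4) h2 := c2 p0.
    apply: filterS2 h1 h2 => p; rewrite -e12 => h1 h2.
    set v := u1 p0.1 p0.2 in h1 h2 *.
    rewrite /blend opprD addrA; apply: le_lt_trans (ler_normB _ _) _.
    rewrite normrZ ger0_norm //.
    have h3 : `|u2 p.1 p.2 - u1 p.1 p.2| <= e / 4 + e / 4.
      apply: le_trans (ler_distD v _ _) _; rewrite (distrC (u2 _ _)).
      by apply: lerD; exact: ltW.
    have : m p.2 * `|u2 p.1 p.2 - u1 p.1 p.2| <= `|u2 p.1 p.2 - u1 p.1 p.2|.
      by rewrite -[leRHS]mul1r; apply: ler_wpM2r.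
    by move: h1; lra.
  have cs (a : par -> RR) : continuous a -> continuous (fun p : X * par => a p.2).
    by move=> ca; apply: comp_cont ca; exact: snd_cont.
  apply: cvgD; first exact: c1.
  apply: cvgZ; last by apply: cvgB; [exact: c2|exact: c1].
  apply: cvgM; first exact: (cs a1 ca1).
  apply: cvgV => //; apply: (@cvgD _ RR^o); [exact: (cs a1 ca1)|exact: (cs a2 ca2)].
- by move=> x t; apply: blend_in.
- by move=> x t a10; rewrite /blend /m a10 mul0r scale0r addr0.
- move=> x t a20; rewrite /blend /m a20 addr0.
  have [a10|a10] := eqVneq (a1 t) 0; first by rewrite a10 mul0r scale0r addr0 agree.
  by rewrite divff // scale1r addrC subrK.
Qed.

(** Iterates [glue2]; the product of the functions glued so far has the union of their zero sets as
    its zero set. *)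
Lemma glue_list (I : Type) (s : seq I) (a : I -> par -> RR) (v : I -> X -> par -> Y)
    (a0 : par -> RR) (u0 : X -> par -> Y) :
  selmap u0 -> continuous a0 -> (forall t, 0 <= a0 t) ->
  (forall i, List.In i s -> selmap (v i)) ->
  (forall i, continuous (a i)) -> (forall i t, 0 <= a i t) ->
  (forall i x t, List.In i s -> a0 t = 0 -> a i t = 0 -> u0 x t = v i x t) ->
  (forall i j x t, List.In i s -> List.In j s -> a i t = 0 -> a j t = 0 ->
     v i x t = v j x t) ->
  exists u (b : par -> RR), [/\ selmap u, continuous b /\ forall t, 0 <= b t,
    forall t, b t = 0 <-> a0 t = 0 \/ exists2 i, List.In i s & a i t = 0,
    forall x t, a0 t = 0 -> u x t = u0 x t &
    forall i x t, List.In i s -> a i t = 0 -> u x t = v i x t].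
Proof.
move=> su0 ca0 pa0 + ca pa; elim: s => [|i s IH] sv ag0 ag.
  by exists u0, a0; split=> // t; split=> [|[//|[]//]]; left.
have [|||u [b [su [cb pb] b0 uu0 uv]]] := IH.
- by move=> j js; apply: sv; right.
- by move=> j x t js; apply: ag0; right.
- by move=> j k x t js ks; apply: ag; right.
have [|w [sw wu wv]] := glue2 su (sv i (or_introl erefl)) cb (ca i) pb (pa i).
  move=> x t /b0[a0t|[j js aj]] ai; first by rewrite uu0 //; apply: ag0 => //; left.
  by rewrite (uv j) //; apply: ag => //; [right|left].
exists w, (fun t => b t * a i t); split=> //.
- by split=> [|t]; [exact: rcontM|rewrite mulr_ge0].
- move=> t; split=> [/eqP|].
    rewrite mulf_eq0 => /orP[/eqP/b0[|[j js aj]]|/eqP ai]; first by left.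
      by right; exists j => //; right.
    by right; exists i => //; left.
  move=> h; apply/eqP; rewrite mulf_eq0; case: h => [a0t|[j [->|js] aj]].
  + by apply/orP; left; apply/eqP/b0; left.
  + by apply/orP; right; apply/eqP.
  + by apply/orP; left; apply/eqP/b0; right; exists j.
- by move=> x t a0t; rewrite wu ?uu0 //; apply/b0; left.
- move=> j x t [<-|js] aj; first exact: wv.
  by rewrite wu ?(uv j) //; apply/b0; right; exists j.
Qed.

Section AtPoint.
Variables (x0 : X) (n : nat).

(** Selections through the values of [h] at a finite net are mixed with weights depending on the
    parameter. At [x0] only net values closer than [d] to [h s] have positive weight, so the mixture
    is also closer than [d]. *)
Lemma extend_map (h : 'rV[RR]_n -> Y) (d : RR) : continuous h ->
  (forall s, phi x0 (h s)) -> 0 < d ->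
  exists2 u, selmap u & forall s, cube n s -> `|h s - u x0 (iota_par s)| < d.
Proof.
move=> ch ph d0; have [r [rK rc]] := compact_net (@cube_compact n) ch d0.
have /choice[g gP] : forall s0 : 'rV[RR]_n, exists f : X -> Y,
    [/\ continuous f, forall x, phi x (f x) & f x0 = h s0].
  by move=> s0; apply: michael_selection_through.
pose w s0 (t : par) := Num.max 0 (d - `|h s0 - h (clamp (pi_par n t))|).
have w0 s0 t : 0 <= w s0 t by rewrite le_max lexx.
have cw s0 : continuous (w s0).
  apply: rcont_max; first exact: cont_cst.
  apply: rcontB; first exact: cont_cst.
  apply: cont_norm; apply: contB; first exact: cont_cst.
  apply: (comp_cont (g := h)) => //.
  by apply: (comp_cont (g := @clamp n)); [exact: pi_par_cont|exact: clamp_cont].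
pose W t := \sum_(s0 <- r) w s0 t.
have cW : continuous W by exact: rcont_sum.
have W0 t : 0 < W t.
  have [s0 s0r hs] := rc _ (@clamp_cube n (pi_par n t)).
  rewrite /W lt_def sumr_ge0 ?andbT // psumr_eq0 //.
  apply/allPn; exists s0 => //=; rewrite /w; rewrite max_r ?subr_eq0 ?gt_eqF //.
  by rewrite subr_ge0 ltW.
pose q s0 t := w s0 t / W t.
have q0 s0 t : 0 <= q s0 t by rewrite divr_ge0 // ltW.
have q1 t : \sum_(s0 <- r) q s0 t = 1 by rewrite -mulr_suml; apply: divff; rewrite gt_eqF //; exact: W0.
exists (fun x t => \sum_(s0 <- r) q s0 t *: g s0 x); first split.
- apply: (@cont_sum _ Y _ r xpredT (fun s0 (p : X * par) => q s0 p.2 *: g s0 p.1)).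
  move=> s0; apply: contZ.
    by have [cg _ _] := gP s0; apply: comp_cont cg; exact: fst_cont.
  apply: comp_cont (@snd_cont _ _) _; apply: rcontM => //.
  by apply: rcontV => // t; rewrite gt_eqF.
- move=> x t; apply: convex_combination => // s0 _.
  by have [_ + _] := gP s0; exact.
- move=> s cs; apply: (@convex_combination Y [set z | `|h s - z| < d]) => //.
    move=> a b /= ha hb t t0 t1.
    have -> : h s - (t *: a + (1 - t) *: b) = t *: (h s - a) + (1 - t) *: (h s - b).
      rewrite !scalerBr addrACA -opprD; congr (_ - _).
      by rewrite -scalerDl addrC subrK scale1r.
    apply: le_lt_trans (ler_normD _ _) _; rewrite !normrZ ger0_norm //.
    by rewrite ger0_norm ?subr_ge0 //; exact: convex_comb_lt.
  move=> s0; rewrite /q mulf_eq0 negb_or => /andP[+ _].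
  have ps : pi_par n (iota_par s) = s.
    by apply/rowP => j; rewrite mxE /iota_par /= valK.
  have [_ _ ->] := gP s0; rewrite /w ps clamp_id // => wn0 /=.
  have : 0 < Num.max 0 (d - `|h s0 - h s|) by rewrite lt_def wn0 le_max lexx.
  by rewrite lt_max ltxx /= subr_gt0 distrC.
Qed.

(** The trace of [F] on [phi x0] is that of a closed set [C]. The density of maps avoiding it gives
    [h] close to [u] at [x0], [extend_map] spreads [h] to selections [u1], and blending with a
    weight that vanishes with [a] leaves [u] unchanged on the zero set of [a]. *)
Lemma perturb (u : X -> par -> Y) (a : par -> RR) (F : set Y) :
  selmap u -> continuous a -> (forall t, 0 <= a t) ->
  Zn_set_in n (phi x0) (phi x0 `&` F) ->
  (forall t, simplex n t -> a t = 0 -> ~ F (u x0 t)) ->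
  exists u', [/\ selmap u', forall x t, a t = 0 -> u' x t = u x t &
    forall t, simplex n t -> ~ F (u' x0 t)].
Proof.
move=> su ca pa Zn aF; have [_ [[C cC FC] _]] := Zn.
have FCP y : phi x0 y -> F y <-> C y.
  move=> py; split=> h.
    by have : (phi x0 `&` F) y by []; rewrite FC => -[].
  by have : (phi x0 `&` C) y by []; rewrite -FC => -[].
pose g s := u x0 (@iota_par n s).
have cg : continuous g.
  apply: (comp_cont (f := fun s => (x0, @iota_par n s)) (g := fun p : X * par => u p.1 p.2)).
    by apply: pair_cont; [exact: cont_cst|exact: iota_par_cont].
  by have [] := su.
have gphi s : phi x0 (g s) by have [_] := su; apply.
have cai : continuous (fun s => a (@iota_par n s)).
  by apply: comp_cont ca; exact: iota_par_cont.
have clc : closed (cube n) := compact_closed (@norm_hausdorff _ _) (@cube_compact n).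
(* Where [a] is below [al], the family already avoids [C]. *)
have [al al0 alP] : exists2 al : RR, 0 < al &
    forall s, cube n s -> C (g s) -> al <= a (iota_par s).
  have cK : compact (cube n `&` g @^-1` C).
    apply: (subclosed_compact _ (@cube_compact n)); last by move=> s [].
    by apply: closedI => //; apply: preimage_closed.
  have [||al al0 alP] := @compact_avoid RR^o _ _ (fun s => a (@iota_par n s)) [set 0] cK cai.
  - by apply: accessible_closed_set1; apply: hausdorff_accessible; exact: Rhausdorff.
  - move=> s [cs Cs] /= a0; apply: (aF _ (iota_simplex cs) a0).
    exact/(FCP _ (gphi s)).
  exists al => // s cs Cs; rewrite leNgt; apply/negP => h.
  by apply: (alP s 0) => //; rewrite subr0 ger0_norm.
have al2 : 0 < al / 2 by rewrite divr_gt0.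
have [||de de0 deP] := @compact_avoid Y _ (cube n `&` [set s | a (iota_par s) <= al / 2]) g C _ cg cC.
- apply: (subclosed_compact _ (@cube_compact n)); last by move=> s [].
  by apply: closedI => //; apply: closed_lefun => //; exact: cont_cst.
- by move=> s [cs /= h] Cs; have := alP s cs Cs; lra.
have de2 : 0 < de / 2 by rewrite divr_gt0.
have [h [ch hF hg]] := Zn_uniform Zn cg (fun s _ => gphi s) de2.
have hphi s : phi x0 (h s) by have [] := hF s.
have [|d2 d20 d2P] := compact_avoid (@cube_compact n) ch cC.
  by move=> s _ Cs; have [ph] := hF s; apply; split=> //; exact/(FCP _ ph).
have [|u1 su1 hu1] := @extend_map h (Num.min d2 (de / 2)) ch hphi.
  by rewrite lt_min d20.
pose m t := Num.min 1 (a t / (al / 2)).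
have m0 t : 0 <= m t by rewrite le_min ler01 divr_ge0 // ltW.
have m1 t : m t <= 1 by rewrite ge_min lexx.
have cm : continuous m.
  apply: rcont_min; first exact: cont_cst.
  by apply: rcontM => //; exact: cont_cst.
have [cu pu] := su; have [cu1 pu1] := su1.
exists (blend u u1 m); split; first split.
- apply: contD => //; apply: contZ; first by apply: contB.
  by apply: comp_cont cm; exact: snd_cont.
- by move=> x t; apply: blend_in.
- by move=> x t a0; rewrite /blend /m a0 mul0r min_r ?ler01 // scale0r addr0.
- move=> t /pi_simplex[cs <-]; set s := pi_par n t in cs *.
  rewrite FCP; last exact: blend_in.
  have := hu1 s cs; rewrite lt_min => /andP[hu1a hu1b].
  (* For small [a] the blend moves [u] by less than [de], the margin there; for large [a] it equals
     [u1], which is within the margin [d2] of [h]. *)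
  case: (leP (a (iota_par s)) (al / 2)) => h1.
    apply: (deP s) => //; rewrite /blend opprD addrA subrr add0r normrN normrZ.
    rewrite ger0_norm //; apply: le_lt_trans (_ : `|u1 x0 (iota_par s) - u x0 (iota_par s)| < de).
      by rewrite -[leRHS]mul1r; apply: ler_wpM2r.
    have := ler_distD (h s) (u1 x0 (iota_par s)) (u x0 (iota_par s)).
    by have := hg s cs; rewrite (distrC (u1 _ _) (h s)) /g; lra.
  have m11 : m (iota_par s) = 1 by rewrite /m min_l // ler_pdivlMr // mul1r ltW.
  by apply: (d2P s) => //; rewrite /blend m11 scale1r subrKC.
Qed.

(** A tube lemma: avoidance of a closed graph is an open condition, and the simplex is the image of
    the compact cube. *)
Lemma tube (u : X -> par -> Y) (psi : X -> set Y) : selmap u -> closed_graph psi ->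
  (forall t, simplex n t -> ~ psi x0 (u x0 t)) ->
  nbhs x0 [set x | forall t, simplex n t -> ~ psi x (u x t)].
Proof.
move=> [cu _] cpsi av; have /compact_near_coveringP cK := @cube_compact n.
have H := cK _ (nbhs x0) (fun x s => ~ psi x (u x (iota_par s))) (nbhs_filter x0).
apply: filterS (H _) => [x hx t /pi_simplex[cs <-]|s cs]; first exact: hx.
have cp : continuous (fun p : 'rV[RR]_n * X => (p.2, u p.2 (iota_par p.1))).
  apply: pair_cont; first exact: snd_cont.
  apply: (comp_cont (f := fun p : 'rV[RR]_n * X => (p.2, iota_par p.1)) (g := fun p => u p.1 p.2)) => //.
  apply: pair_cont; first exact: snd_cont.
  by apply: comp_cont (@iota_par_cont n); exact: fst_cont.
have nb : nbhs (x0, u x0 (iota_par s)) (~` [set p : X * Y | psi p.1 p.2]).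
  apply: open_nbhs_nbhs; split; first exact: closed_openC.
  by apply: av; exact: iota_simplex.
exact: (cp (s, x0) _ nb).
Qed.

End AtPoint.

(** * Towers of selections over the nerves of successive covers *)

Variables (psi : nat -> X -> set Y).
Hypotheses (psic : forall n, closed_graph (psi n)) (psid : decreasing_family psi)
  (psiZ : zseq_for phi psi).

(** Names one vertex in each cover, all covers being indexed by the points of [X]. *)
Definition chain := nat -> X.

Definition agree n (c c' : chain) (t : par) :=
  forall i, (i < n)%N -> t i != 0 -> c i = c' i.

Lemma agree_sym n c c' t : agree n c c' t -> agree n c' c t.
Proof. by move=> h i lin ti; rewrite h. Qed.

Lemma agree_trans n c1 c2 c3 t : agree n c1 c2 t -> agree n c2 c3 t -> agree n c1 c3 t.
Proof. by move=> h h' i lin ti; rewrite h // h'. Qed.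

(** Closures are used because, for a locally finite cover, the points near [w] lie in no closures
    but those containing [w]. *)
Definition at_chain (V : nat -> X -> set X) n (c : chain) (x : X) :=
  forall i, (i < n)%N -> closure (V i (c i)) x.

(* [u c] is a family of selections over the simplex spanned by the vertices
   [c 0, ..., c n.-1] of the nerves of the covers [V 0, ..., V n.-1]; vertices
   with zero barycentric coordinate are irrelevant. *)
Record tower (n : nat) (V : nat -> X -> set X) (u : chain -> X -> par -> Y) : Prop := {
  tower_open : forall i, (i < n)%N -> forall z, open (V i z);
  tower_cover : forall i, (i < n)%N -> forall x, exists z, V i z x;
  tower_lfin : forall i, (i < n)%N -> lfin setT (V i);
  tower_sel : forall c, selmap (u c);
  tower_agree : forall c c' x x' t, at_chain V n c x -> at_chain V n c' x' ->
    agree n c c' t -> forall y, u c y t = u c' y t;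
  tower_avoid : forall m c x t, n = m.+1 -> at_chain V n c x -> simplex m t ->
    ~ psi m x (u c x t) }.

Lemma disagreement n (c c' : chain) : exists a : par -> RR,
  [/\ continuous a, forall t, 0 <= a t & forall t, a t = 0 <-> agree n c c' t].
Proof.
exists (fun t => \sum_(i < n | `[< c i <> c' i >]) `|t i|); split.
- by apply: rcont_sum => i; apply: rcont_norm; exact: par_coord.
- by move=> t; apply: sumr_ge0.
- move=> t; split=> [a0 i lin ti|ag].
    apply: contrapT => ci; move: ti; apply/negP; rewrite negbK.
    have /eqP := a0; rewrite psumr_eq0 // => /allP /(_ (Ordinal lin)).
    rewrite mem_index_enum => /(_ isT) /implyP /=; rewrite normr_eq0; apply.
    exact/asboolP.
  rewrite big1 // => i /asboolP ci; apply/eqP; rewrite normr_eq0.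
  by apply: contrapT => /negP ti; apply: ci; exact: ag.
Qed.

(** Chains are treated one at a time. For a new chain [c] the values are prescribed on the face
    [t n = 0] by [u c] and on the faces shared with earlier chains; these are glued, then perturbed
    off the prescribed part to avoid [psi n] at [w]. *)
Lemma chains_extension n V u (w : X) (s : seq chain) : tower n V u ->
  (forall c, List.In c s -> at_chain V n c w) ->
  exists v : chain -> X -> par -> Y,
    [/\ forall c, List.In c s -> selmap (v c),
    forall c x t, List.In c s -> t n = 0 -> v c x t = u c x t,
    forall c c' x t, List.In c s -> List.In c' s -> agree n c c' t -> v c x t = v c' x t &
    forall c t, List.In c s -> simplex n t -> ~ psi n w (v c w t)].
Proof.
move=> tw; elim: s => [|c s IH] sw; first by exists u; split.
have [|v [vs vu va vp]] := IH; first by move=> c' c's; apply: sw; right.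
have cw : at_chain V n c w by apply: sw; left.
have /choice[a aP] := disagreement n c.
have [|||||||u1 [b [su1 [cb pb] b0 u1u u1v]]] :=
  @glue_list chain s a v (fun t : par => `|t n|) (u c) (tower_sel tw c).
- by apply: rcont_norm; exact: par_coord.
- by [].
- exact: vs.
- by move=> c'; have [] := aP c'.
- by move=> c'; have [] := aP c'.
- move=> c' x t c's /eqP; rewrite normr_eq0 => /eqP tn.
  have [_ _ /(_ t) h] := aP c'; move=> /h ag; rewrite vu //.
  by apply: (tower_agree tw cw _ ag); apply: sw; right; exact: c's.
- move=> c' c'' x t c's c''s; have [_ _ /(_ t) h'] := aP c'.
  have [_ _ /(_ t) h''] := aP c''; move=> /h' ag' /h'' ag''.
  by apply: va => //; apply: agree_trans ag''; exact: agree_sym.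
(* On the prescribed part avoidance is known: on the face [t n = 0] the tower avoids the previous
   set of the decreasing sequence, elsewhere the induction hypothesis applies. *)
have [t st bt|u2 [su2 u2u1 u2p]] := perturb su1 cb pb (psiZ w n).
  have [/eqP|[c' c's ac]] := iffLR (b0 t) bt.
    rewrite normr_eq0 => /eqP tn; have [m nm sm] := simplex_face st tn.
    rewrite u1u; last by rewrite tn normr0.
    move=> pn; apply: (tower_avoid tw nm cw sm); apply: psid.
    by rewrite -nm.
  by rewrite (u1v c') //; exact: vp.
pose v' c' := if pselect (c' = c) then u2 else v c'.
have v'c : v' c = u2 by rewrite /v'; case: pselect.
have v'n c' : c' <> c -> v' c' = v c' by rewrite /v'; case: pselect.
have u2v c' x t : List.In c' s -> agree n c c' t -> u2 x t = v c' x t.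
  move=> c's; have [_ _ /(_ t) h] := aP c'; move=> /h ac.
  by rewrite u2u1 ?(u1v c') //; apply/b0; right; exists c'.
have u2u x t : t n = 0 -> u2 x t = u c x t.
  move=> tn; have tn0 : `|t n| = 0 by rewrite tn normr0.
  by rewrite u2u1 ?u1u //; apply/b0; left.
have inS c' : List.In c' (c :: s) -> c' = c \/ c' <> c /\ List.In c' s.
  by have [->|ne] := pselect (c' = c); [left|move=> [/esym//|?]; right].
exists v'; split.
- by move=> c' /inS[->|[ne c's]]; [rewrite v'c|rewrite v'n //; exact: vs].
- move=> c' x t /inS[->|[ne c's]] tn; first by rewrite v'c u2u.
  by rewrite v'n // vu.
- move=> c' c'' x t /inS[->|[ne c's]] /inS[->|[ne' c''s]] ag //.
  + by rewrite v'c v'n //; exact: u2v.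
  + by rewrite v'c v'n //; apply/esym/u2v => //; exact: agree_sym.
  + by rewrite !v'n //; exact: va.
- move=> c' t /inS[->|[ne c's]] st; first by rewrite v'c; exact: u2p.
  by rewrite v'n //; exact: vp.
Qed.

(** Entries from [n] on are frozen at [w], which leaves one representative for each choice of the
    first [n] vertices. *)
Lemma finite_chains n (w : X) (A : nat -> set X) : (forall i, (i < n)%N -> finite_set (A i)) ->
  finite_set [set c : chain | (forall i, (i < n)%N -> A i (c i)) /\
    forall i, (n <= i)%N -> c i = w].
Proof.
elim: n => [|n IH] fA.
  apply: (@sub_finite_set _ _ [set (fun=> w)]); last exact: finite_set1.
  by move=> c [_ h]; apply/funext => i; exact: h.
have f1 := IH (fun i lin => fA i (leqW lin)).
pose ins (cz : chain * X) : chain := fun i => if i == n then cz.2 else cz.1 i.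
apply: (@sub_finite_set _ _ (ins @` ([set c : chain | (forall i, (i < n)%N -> A i (c i)) /\
    forall i, (n <= i)%N -> c i = w] `*` A n))); last first.
  by apply: finite_image; apply: finite_setX => //; exact: fA.
move=> c [cA cw]; exists (fun i => if (i < n)%N then c i else w, c n).
  split=> /=; last exact: cA.
  split=> i; first by move=> lin; rewrite lin; apply: cA; exact: leqW.
  by rewrite leqNgt => /negbTE ->.
apply/funext => i; rewrite /ins /=; case: eqP => [->//|/eqP ne].
by case: ltngtP ne => // ni _; rewrite cw.
Qed.

Lemma finite_set_list (C : Type) (S : set C) : finite_set S ->
  exists s : seq C, forall c, S c <-> List.In c s.
Proof.
elim/Pchoice: C => C in S *; move=> fS; exists (fset_set S) => c.
rewrite In_mem in_fset_set //; split=> [Sc|/set_mem//]; exact: mem_set.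
Qed.

Lemma lfin_nbhs (V : X -> set X) (w : X) : lfin setT V ->
  finite_set [set z | closure (V z) w] /\
  nbhs w [set x | forall z, closure (V z) x -> closure (V z) w].
Proof.
move=> lV; have [N wN fN] := lV w; split.
  by apply: sub_finite_set fN => z /(_ N wN).
have n1 : nbhs w [set x | forall z, ([set z | setT z /\ V z `&` N !=set0] `&`
    [set z | ~ closure (V z) w]) z -> (~` closure (V z)) x].
  apply: near_finite; first by apply: sub_finite_set fN => z [].
  move=> z [_ nz]; apply: open_nbhs_nbhs; split=> //.
  exact/closed_openC/closed_closure.
have n2 : nbhs w N° by exact: nbhs_interior.
apply: filterS2 n1 n2 => x h Nx z clx; apply: contrapT => nw.
by apply: (h z) => //; split=> //; split=> //; exact: clx Nx.
Qed.

(** Truncation by [tr] reduces the chains at [w] to a finite list. Near [w] no new closures appear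
    and, by [tube], avoidance at [w] persists. *)
Lemma tower_local n V u (w : X) : tower n V u ->
  exists (W : set X) (v : chain -> X -> par -> Y), [/\ open W, W w,
    forall i z x, (i < n)%N -> W x -> closure (V i z) x -> closure (V i z) w &
    [/\ forall c, at_chain V n c w -> selmap (v c),
    forall c x t, at_chain V n c w -> t n = 0 -> v c x t = u c x t,
    forall c c' x t, at_chain V n c w -> at_chain V n c' w -> agree n c c' t ->
      v c x t = v c' x t &
    forall c x t, at_chain V n c w -> W x -> simplex n t -> ~ psi n x (v c x t)]].
Proof.
move=> tw.
have fin i : (i < n)%N -> finite_set [set z | closure (V i z) w].
  by move=> lin; have [] := lfin_nbhs w (tower_lfin tw lin).
have /finite_set_list[s sP] := finite_chains w fin.
have [|v [vs vu va vp]] := @chains_extension n V u w s tw.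
  by move=> c /sP[].
pose tr (c : chain) : chain := fun i => if (i < n)%N then c i else w.
have trs c : at_chain V n c w -> List.In (tr c) s.
  move=> cw; apply/sP; split=> i; rewrite /tr; last by rewrite leqNgt => /negbTE ->.
  by move=> lin; rewrite lin; exact: cw.
have tra c t : agree n (tr c) c t by move=> i lin _; rewrite /tr lin.
pose N := [set x | (forall i, `I_n i ->
    forall z, closure (V i z) x -> closure (V i z) w) /\
  forall c, [set c | List.In c s] c -> forall t, simplex n t -> ~ psi n x (v c x t)].
have nN : nbhs w N.
  apply: filterI.
    apply: (near_finite (A := fun i => [set x | forall z, closure (V i z) x -> closure (V i z) w])).
      exact: finite_II.
    by move=> i lin; have [] := lfin_nbhs w (tower_lfin tw lin).
  apply: (near_finite (A := fun c => [set x | forall t, simplex n t -> ~ psi n x (v c x t)])).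
    apply: sub_finite_set (finite_chains w fin) => c; exact: (iffRL (sP c)).
  by move=> c cs; apply: tube => //; [exact: vs|move=> t; exact: vp].
exists N°, (fun c => v (tr c)); split; first exact: open_interior.
- exact: nN.
- by move=> i z x lin /interior_subset[h _]; exact: h.
split.
- by move=> c /trs; exact: vs.
- move=> c x t cw tn; rewrite vu //; last exact: trs.
  apply: (tower_agree tw _ cw (tra c t)) => i lin; rewrite /tr lin; exact: cw.
- move=> c c' x t cw cw' ag; apply: va; [exact: trs|exact: trs|].
  apply: agree_trans (tra c t) _; apply: agree_trans ag _.
  by apply: agree_sym; exact: tra.
- by move=> c x t /trs cs /interior_subset[_ h]; exact: h.
Qed.

(** The sets of the new cover shrink the neighbourhoods [W], and the new vertex [c n] tells at which
    point the local extension was made. Chains agreeing on a face with [t n] nonzero use the same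
    extension; on [t n = 0] all extensions reduce to [u]. *)
Lemma tower_step n V u : tower n V u -> exists V' u', tower n.+1 V' u' /\
  forall i, (i < n)%N -> V' i = V i.
Proof.
move=> tw.
have /choice[Wv WvP] : forall w, exists Wv : set X * (chain -> X -> par -> Y),
   [/\ open Wv.1, Wv.1 w,
    forall i z x, (i < n)%N -> Wv.1 x -> closure (V i z) x -> closure (V i z) w &
    [/\ forall c, at_chain V n c w -> selmap (Wv.2 c),
    forall c x t, at_chain V n c w -> t n = 0 -> Wv.2 c x t = u c x t,
    forall c c' x t, at_chain V n c w -> at_chain V n c' w -> agree n c c' t ->
      Wv.2 c x t = Wv.2 c' x t &
    forall c x t, at_chain V n c w -> Wv.1 x -> simplex n t -> ~ psi n x (Wv.2 c x t)]].
  by move=> w; have [W [v Wv]] := tower_local w tw; exists (W, v).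
have [||Vn [oVn clVn cVn lVn]] := @paracompact_shrink X hX X (fun w => (Wv w).1).
- by move=> w; have [] := WvP w.
- by move=> x; exists x; have [] := WvP x.
pose V' i := if i == n then Vn else V i.
have V'n : V' n = Vn by rewrite /V' eqxx.
have V'i i : (i < n)%N -> V' i = V i by rewrite /V' ltn_neqAle => /andP[/negbTE ->].
(* Chains not at their own last vertex keep the old [u c], which still is a family of selections. *)
pose u' c := if pselect (at_chain V n c (c n)) then (Wv (c n)).2 c else u c.
have at_n c x : at_chain V' n.+1 c x -> at_chain V n c x /\ closure (Vn (c n)) x.
  move=> h; split; last by have := h n (ltnSn n); rewrite V'n.
  by move=> i lin; have := h i (leqW lin); rewrite V'i.
have at_c c x : at_chain V' n.+1 c x -> at_chain V n c (c n).
  move=> /at_n[h cl] i lin; have [_ _ hW _] := WvP (c n).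
  by apply: (hW i _ x) => //; [exact: clVn|exact: h].
have u'c c x : at_chain V' n.+1 c x -> u' c = (Wv (c n)).2 c.
  by move=> /at_c h; rewrite /u'; case: pselect.
exists V', u'; split; last exact: V'i.
split.
- move=> i; rewrite ltnS leq_eqVlt => /orP[/eqP -> z|lin z]; first by rewrite V'n.
  by rewrite V'i //; exact: (tower_open tw).
- move=> i; rewrite ltnS leq_eqVlt => /orP[/eqP ->|lin]; first by rewrite V'n.
  by rewrite V'i //; exact: (tower_cover tw).
- move=> i; rewrite ltnS leq_eqVlt => /orP[/eqP ->|lin]; first by rewrite V'n.
  by rewrite V'i //; exact: (tower_lfin tw).
- move=> c; rewrite /u'; case: pselect => h; last exact: tower_sel tw c.
  by have [_ _ _ [hs _ _ _]] := WvP (c n); exact: hs.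
- move=> c c' x x' t cx c'x' ag y.
  have ag' : agree n c c' t by move=> i lin; apply: ag; exact: leqW.
  rewrite (u'c c x) // (u'c c' x') //.
  have [_ _ _ [_ hu _ _]] := WvP (c n); have [_ _ _ [_ hu' _ _]] := WvP (c' n).
  have cc := at_c _ _ cx; have cc' := at_c _ _ c'x'.
  have [tn|tn] := eqVneq (t n) 0.
    by rewrite hu // hu' //; exact: (tower_agree tw cc cc').
  have cnn : c n = c' n by exact: ag.
  rewrite -cnn in cc' *; have [_ _ _ [_ _ + _]] := WvP (c n); exact.
- move=> m c x t [<-] cx st; rewrite (u'c c x) //.
  have [_ _ _ [_ _ _]] := WvP (c n); apply=> //; first exact: at_c cx.
  by apply: clVn; have [] := at_n _ _ cx.
Qed.

Lemma towers : exists (V : nat -> X -> set X) (u : nat -> chain -> X -> par -> Y),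
  forall n, tower n V (u n).
Proof.
have [f cf sf] := michael_selection hX phic phil.
have tw0 : tower 0 (fun _ _ => set0) (fun _ x _ => f x).
  split=> // c; split=> [|x t]; last exact: sf.
  by apply: comp_cont cf; exact: fst_cont.
have /choice[nxt nxtP] : forall nVu : nat * ((nat -> X -> set X) * (chain -> X -> par -> Y)),
    exists Vu : (nat -> X -> set X) * (chain -> X -> par -> Y),
    tower nVu.1 nVu.2.1 nVu.2.2 -> tower nVu.1.+1 Vu.1 Vu.2 /\
    forall i, (i < nVu.1)%N -> Vu.1 i = nVu.2.1 i.
  move=> [n [V u]]; have [tw|ntw] := pselect (tower n V u); last by exists (V, u).
  by have [V' [u' h]] := tower_step tw; exists (V', u').
pose st := fix st n := if n is m.+1 then nxt (m, st m) else
  ((fun _ _ => set0, fun _ x _ => f x) : (nat -> X -> set X) * (chain -> X -> par -> Y)).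
have stw n : tower n (st n).1 (st n).2.
  by elim: n => [|n IH] //; exact: (nxtP (n, st n) IH).1.
have stV n i : (i < n)%N -> (st n).1 i = (st i.+1).1 i.
  elim: n => // n IH; rewrite ltnS leq_eqVlt => /orP[/eqP ->//|lin].
  by rewrite -(IH lin); exact: (nxtP (n, st n) (stw n)).2.
exists (fun i => (st i.+1).1 i), (fun n => (st n).2) => n.
(* A step leaves the earlier covers unchanged, so the diagonal sequence agrees with stage [n] below
   [n]. *)
have [h1 h2 h3 h4 h5 h6] := stw n.
have atE c x : at_chain (fun i => (st i.+1).1 i) n c x -> at_chain (st n).1 n c x.
  by move=> h i lin; rewrite stV //; exact: h.
split=> //.
- by move=> i lin z; rewrite -(stV n i lin); exact: h1.
- by move=> i lin x; rewrite -(stV n i lin); exact: h2.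
- by move=> i lin; rewrite -(stV n i lin); exact: h3.
- by move=> c c' x x' t /atE cx /atE cx'; exact: h5 cx cx'.
- by move=> m c x t nm /atE cx; exact: h6.
Qed.

(** A partition of unity subordinate to the [D n] gives coordinates [lam x], and the piece of [D n]
    containing [x] gives the vertex [c x n]. For [n < k], where no piece contains [x] the vertex is
    arbitrary, but its coordinate vanishes. *)
Theorem avoiding_selection : finite_C_space X ->
  exists (m : nat) (f : X -> Y), continuous f /\ forall x, (phi x `\` psi m x) (f x).
Proof.
move=> hC; have [V [u tw]] := towers.
have [||k [D [dD cD]]] := finite_C_disjoint_refinement hX (V := V) hC.
- by move=> n z; exact: (tower_open (tw n.+1)).
- by move=> n x; exact: (tower_cover (tw n.+1)).
have /choice[G GP] : forall n, exists g : X -> set X, (n < k)%N ->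
  [/\ forall i, open (g i), forall i, g i `<=` V n i,
    forall i j x, g i x -> g j x -> i = j & forall x, D n x <-> exists i, g i x].
  move=> n; case: (ltnP n k) => nk; last by exists (fun=> set0).
  by have [g gP] := dD n nk; exists g.
pose O n := if (n < k)%N then D n else set0.
have [||p [cp p0 sp _ p1]] := @partition_of_unity X hX nat O.
- by move=> n; rewrite /O; case: ifP => nk; [exact: dsm_open (dD n nk)|exact: open0].
- by move=> x; have [n nk Dn] := cD x; exists n; rewrite /O nk.
have pk n x : (k <= n)%N -> p n x = 0.
  move=> kn; apply: contrapT => /eqP pn.
  have : closure [set x | p n x != 0] x by exact: subset_closure.
  by move=> /(sp n); rewrite /O ltnNge kn.
have sum1 x : \sum_(n < k) p n x = 1.
  rewrite -(p1 x) (@fsbig_ord RR 0 +%R k (p^~ x)); apply: fsbig_widen => //.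
  by move=> i [_ /= /negP]; rewrite -leqNgt; exact: pk.
pose lam x : par := fun n => p n x.
have clam : continuous lam by apply: par_cont.
have /choice[c cP] : forall x, exists c : chain,
    (forall n, (n < k)%N -> V n (c n) x) /\
    forall n z, (n < k)%N -> G n z x -> c n = z.
  move=> x; suff /choice[c cP] : forall n, exists z, V n z x /\
      forall z', (n < k)%N -> G n z' x -> z = z'.
    by exists c; split=> n; [move=> _; have [] := cP n|move=> z; have [_] := cP n; apply].
  move=> n; have [[z [nk Gz]]|nG] := pselect (exists z, (n < k)%N /\ G n z x).
    have [_ GV dG _] := GP n nk; exists z; split; first exact: GV Gz.
    by move=> z' _; exact: dG Gz.
  have [z Vz] := tower_cover (tw n.+1) (ltnSn n) x; exists z; split=> // z' nk Gz.
  by case: nG; exists z'.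
have atc x : at_chain V k (c x) x.
  by move=> i ik; apply: subset_closure; have [h _] := cP x; exact: h.
(* Zero families cover only the empty space, where any map will do. *)
case: k => [|m] in dD cD GP O sp pk sum1 cP atc *.
  exists 0%N, (fun=> 0); split; first exact: cont_cst.
  by move=> x; have [n] := cD x.
exists m, (fun x => u m.+1 (c x) x (lam x)); split; last first.
  move=> x; split; first by have [_ +] := tower_sel (tw m.+1) (c x); apply.
  (* The coordinates are nonnegative with sum [1], so the cut-off in coordinate [0] has no
     effect. *)
  apply: (tower_avoid (tw m.+1) erefl) => //; split.
  - by move=> i mi; exact: pk.
  - move=> i /andP[_ im]; have im' : (i < m.+1)%N by [].
    rewrite /lam p0 -(sum1 x) (bigD1 (Ordinal im')) //=.
    by rewrite lerDl sumr_ge0.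
  - have := sum1 x; rewrite big_ord_recl /lam /= => s1.
    have -> : 1 - \sum_(j < m) p j.+1 x = p 0%N x by rewrite -s1 addrK.
    by rewrite max_r.
move=> x0.
(* Near [x0] the chain can change only at vertices of zero coordinate, so the map coincides there
   with the continuous family of the fixed chain [c x0]. *)
have near_agree : nbhs x0 [set x | agree m.+1 (c x) (c x0) (lam x)].
  apply: (near_finite (D := `I_m.+1)
    (A := fun n => [set x | lam x n != 0 -> c x n = c x0 n])); first exact: finite_II.
  move=> n /= nk; have [oG GV dG DG] := GP n nk.
  have [[z Gz]|nG] := pselect (exists z, G n z x0).
    have nz : nbhs x0 (G n z) by apply: open_nbhs_nbhs; split.
    apply: filterS nz => x Gx _.
    by have [_ h] := cP x; have [_ h'] := cP x0; rewrite (h n z) // (h' n z).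
  have nb : nbhs x0 (~` closure [set x | p n x != 0]).
    apply: open_nbhs_nbhs; split; first exact/closed_openC/closed_closure.
    by move=> /(sp n); rewrite /O nk => /DG.
  by apply: filterS nb => x ncl pn; case: ncl; exact: subset_closure.
have cc : continuous (fun x => u m.+1 (c x0) x (lam x)).
  have [cu _] := tower_sel (tw m.+1) (c x0).
  exact: (comp_cont (pair_cont (fun x => @cvg_id _ (nbhs x)) clam) cu).
apply: cvg_trans (cc x0).
apply: near_eq_cvg; apply: filterS near_agree => x ag /=.
by apply/esym; exact: (tower_agree (tw m.+1) (atc x) (atc x0)).
Qed.

End ParametrizedSelections.

(** * Bounded functions *)

Section BoundedFunctions.

Definition bounded_fun_pred : {pred (nat * nat -> RR^o)} :=
  fun f => `[< exists M : RR, forall k, `|f k| <= M >].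

Lemma bounded_fun_submod : submod_closed bounded_fun_pred.
Proof.
split; first by apply/asboolP; exists 0 => k; rewrite normr0.
move=> a f g /asboolP[M fM] /asboolP[N gN]; apply/asboolP.
exists (`|a| * M + N) => k; apply: le_trans (ler_normD _ _) _.
by apply: lerD => //; rewrite normrM; apply: ler_wpM2l.
Qed.

HB.instance Definition _ :=
  GRing.isSubmodClosed.Build RR (nat * nat -> RR^o) bounded_fun_pred bounded_fun_submod.

Record bfun := BFun { bval :> nat * nat -> RR^o; bvalP : bval \in bounded_fun_pred }.

HB.instance Definition _ := [isSub for bval].
HB.instance Definition _ := [Choice of bfun by <:].
HB.instance Definition _ := [SubChoice_isSubLmodule of bfun by <:].

Definition bnorm (f : bfun) : RR := sup [set `|f k| | k in [set: nat * nat]].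

Lemma bnorm_ge (f : bfun) k : `|f k| <= bnorm f.
Proof.
apply: ub_le_sup; last by exists k.
by have /asboolP[M fM] := bvalP f; exists M => _ [j _ <-].
Qed.

Lemma bnorm_le (f : bfun) M : (forall k, `|f k| <= M) -> bnorm f <= M.
Proof.
move=> fM; apply: ge_sup; first by exists `|f (0%N, 0%N)|, (0%N, 0%N).
by move=> _ [k _ <-].
Qed.

Lemma bnormD f g : bnorm (f + g) <= bnorm f + bnorm g.
Proof.
apply: bnorm_le => k; apply: le_trans (ler_normD _ _) _.
by apply: lerD; exact: bnorm_ge.
Qed.

Lemma bnormZ (a : RR) f : bnorm (a *: f) = `|a| * bnorm f.
Proof.
have H (b : RR) g : bnorm (b *: g) <= `|b| * bnorm g.
  apply: bnorm_le => k; rewrite [(b *: g) k](_ : _ = b * g k) // normrM.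
  by apply: ler_wpM2l => //; exact: bnorm_ge.
have [->|a0] := eqVneq a 0.
  apply/eqP; rewrite eq_le H normr0 mul0r /=.
  by apply: le_trans (bnorm_ge _ (0%N, 0%N)).
apply/eqP; rewrite eq_le H /= mulrC -ler_pdivlMr ?normr_gt0 //.
have := H a^-1 (a *: f); rewrite scalerA mulVf // scale1r => h.
by rewrite mulrC -normfV.
Qed.

Lemma bnorm_eq0 f : bnorm f = 0 -> f = 0.
Proof.
move=> f0; apply/val_inj/funext => k; apply/eqP.
by rewrite -normr_le0 -f0; exact: bnorm_ge.
Qed.

HB.instance Definition _ :=
  @Lmodule_isNormed.Build RR bfun bnorm bnormD bnormZ bnorm_eq0.

Lemma bfun_norm_ge (f : bfun) k : `|f k| <= `|f|.
Proof. exact: bnorm_ge. Qed.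

Lemma bfun_norm_le (f : bfun) M : (forall k, `|f k| <= M) -> `|f| <= M.
Proof. exact: bnorm_le. Qed.

(** The limit is taken coordinatewise; the estimate [close] is uniform in the coordinate, which
    gives both its boundedness and convergence in norm. *)
Lemma bfun_complete (F : set_system bfun) : ProperFilter F -> cauchy F -> cvg F.
Proof.
move=> FF /cauchyP cF.
have crd e : 0 < e -> exists f : bfun, F [set g | `|f - g| < e].
  by move=> e0; have [f Ff] := cF e e0; exists f; move: Ff; rewrite -ball_normE.
have cvk k : cvg ((fun f : bfun => (f k : RR)) @ F).
  apply: (@cauchy_cvg RR^o); apply/cauchy_exP => e e0.
  have [f Ff] := crd e e0; exists (f k); rewrite /nbhs /=.
  apply: filterS Ff => g /= fg; rewrite /ball /=.
  exact: le_lt_trans (bnorm_ge (f - g) k) fg.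
pose l k : RR^o := lim ((fun f : bfun => (f k : RR)) @ F).
have close (f : bfun) (e : RR) : F [set g | `|f - g| < e] -> forall k, `|f k - l k| <= e.
  move=> Ff k.
  have cl : closed [set z : RR | `|f k - z| <= e].
    apply: closed_lefun; last exact: cont_cst.
    by apply: rcont_norm; apply: rcontB; [exact: cont_cst|move=> ?; exact: cvg_id].
  have nr : \forall g \near F, `|f k - (g : bfun) k| <= e.
    by apply: filterS Ff => g /= fg; apply: le_trans (bnorm_ge (f - g) k) (ltW fg).
  exact: (closed_cvg _ cl nr _ (cvk k)).
have lb : l \in bounded_fun_pred.
  have [f Ff] := crd 1 ltr01; apply/asboolP; exists (`|f| + 1) => k.
  have -> : l k = f k - (f k - l k) by rewrite opprB addrC subrK.
  apply: le_trans (ler_normB _ _) _; apply: lerD; first exact: bnorm_ge.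
  exact: close Ff k.
apply/cvg_ex; exists (BFun lb); apply/cvgrPdist_lt => e e0.
have e3 : 0 < e / 3 by rewrite divr_gt0.
have [f Ff] := crd (e / 3) e3; apply: filterS (Ff) => g /= fg.
have fl : `|BFun lb - f| <= e / 3.
  apply: bnorm_le => k; rewrite distrC; exact: close Ff k.
have := ler_distD f (BFun lb) g; lra.
Qed.

HB.instance Definition _ := Uniform_isComplete.Build bfun bfun_complete.

Lemma bcoord_cont k : continuous (fun f : bfun => (f k : RR)).
Proof.
move=> f; apply/(@cvgrPdist_lt RR RR^o bfun (nbhs f) (nbhs_filter f)) => e e0.
have /cvgrPdist_lt /(_ e e0) := @cvg_id _ (nbhs f).
by apply: filterS => g; apply: le_lt_trans; exact: (bnorm_ge (f - g) k).
Qed.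

End BoundedFunctions.

(** * Colouring the cube *)

Section Grid.

Lemma cube_uniform (Y : completeNormedModType RR) n (g : 'rV[RR]_n -> Y) (e : RR) :
  continuous g -> 0 < e -> exists M : nat, forall t t' : 'rV[RR]_n, cube n t ->
    (forall j, `|t ord0 j - t' ord0 j| < M.+1%:R^-1) -> `|g t - g t'| < e.
Proof.
move=> cg e0; have /compact_near_coveringP cK := @cube_compact n.
have e2 : 0 < e / 2 by rewrite divr_gt0.
have := cK _ (0^'+) (fun d t => forall t' : 'rV[RR]_n, (forall j, `|t ord0 j - t' ord0 j| < d) ->
  `|g t - g t'| < e) _.
case=> [t ct|d0 /= d0p dP]; last first.
  have dm0 : 0 < d0 / 2 by rewrite divr_gt0.
  have dlt : d0 / 2 < d0 by rewrite ltr_pdivrMr // ltr_pMr // ltr1n.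
  (* With this [M] the mesh [M.+1%:R^-1] is below [d0 / 2]. *)
  exists (Num.truncn (d0 / 2)^-1) => t t' ct tt'.
  have hd : `|0 - d0 / 2| < d0 by rewrite sub0r normrN gtr0_norm.
  apply: (dP (d0 / 2) hd dm0 t ct t') => j; apply: lt_trans (tt' j) _.
  have dV0 : 0 <= (d0 / 2)^-1 by rewrite invr_ge0 ltW.
  have /andP[_ h] := truncn_itv dV0.
  by rewrite -[ltRHS]invrK ltf_pV2 // posrE ?invr_gt0 // ltr0n.
have /cvgrPdist_lt/(_ _ e2)/nbhs_ballP[d /= dp dP] := cg t.
have d2 : 0 < d / 2 by rewrite divr_gt0.
exists (ball t (d / 2), [set r | 0 < r -> r < d / 2]) => /=.
  split; first exact: nbhsx_ballx.
  exists (d / 2) => //= r /=; rewrite sub0r normrN => h r0.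
  by rewrite gtr0_norm in h.
move=> [t1 r] /= [[_ tt1] hr] t' t1t'.
have n1 : `|g t - g t1| < e / 2.
  apply: dP; split=> // i j; rewrite /ball /=.
  by apply: lt_trans (tt1 i j) _; rewrite ltr_pdivrMr // ltr_pMr // ltr1n.
have n2 : `|g t - g t'| < e / 2.
  apply: dP; split=> // i j; rewrite /ball /= !ord1.
  apply: le_lt_trans (ler_distD (t1 ord0 j) _ _) _.
  have := tt1 ord0 j; rewrite /ball /= => h1; have h2 := t1t' j.
  have r0 : 0 < r by apply: le_lt_trans h2.
  by have := hr r0; lra.
have := ler_distD (g t) (g t1) (g t'); rewrite (distrC (g t1) (g t)); lra.
Qed.

Variable N : nat.
Hypothesis N0 : (0 < N)%N.

(* A tent over the interval from [N (k - 1) + l] to [N k + l]. A point is missed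
   by the plateaus of at most one colour [l < N]; hence a point of the cube is on
   plateaus in all [n] coordinates for at least one of [n + 1] colours. *)
Definition bump (l k : nat) (q : RR) : RR :=
  Num.max 0 (Num.min 1 (2 * Num.min (q - ((N * k + l)%:R - N%:R)) ((N * k + l)%:R - q))).

Lemma bump_cont (Z : topologicalType) l k (f : Z -> RR) : continuous f ->
  continuous (fun z => bump l k (f z)).
Proof.
move=> cf; apply: rcont_max; first exact: cont_cst.
apply: rcont_min; first exact: cont_cst.
apply: rcontM; first exact: cont_cst.
by apply: rcont_min; apply: rcontB => //; exact: cont_cst.
Qed.

Lemma bump_ge0 l k q : 0 <= bump l k q.
Proof. by rewrite le_max lexx. Qed.

Lemma bump_le1 l k q : bump l k q <= 1.
Proof. by rewrite ge_max ler01 ge_min lexx. Qed.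

Lemma bump_gt0 l k q : 0 < bump l k q ->
  (N * k + l)%:R - N%:R < q /\ q < (N * k + l)%:R.
Proof.
rewrite /bump lt_max ltxx /= lt_min => /andP[_].
by rewrite pmulr_rgt0 // lt_min !subr_gt0 => /andP[].
Qed.

Lemma bump_uniq l k k' q : 0 < bump l k q -> 0 < bump l k' q -> k = k'.
Proof.
have H i j : (i < j)%N -> 0 < bump l i q -> 0 < bump l j q -> False.
  move=> ij /bump_gt0[_ h1] /bump_gt0[h2 _].
  have : ((N * i + l) + N <= N * j + l)%N by nia.
  by rewrite -(ler_nat RR) natrD; lra.
by move=> bk bk'; case: (ltngtP k k') => // kk'; [have := H _ _ kk' bk bk'|have := H _ _ kk' bk' bk].
Qed.

(** Take the least [k] whose tent ends beyond [q]. At distance at least [1/2] from both ends the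
    tent has value [1]; otherwise [q] is near an end, an integer congruent to [l]. *)
Lemma bump_cases l M q : (l < N)%N -> 0 <= q -> q <= (N * M)%:R ->
  (exists2 k, (k < M.+2)%N & bump l k q = 1) \/
  exists2 z, (z %% N)%N = l & `|q - z%:R| < 1/2.
Proof.
move=> lN q0 qM.
have ex : exists k, q < (N * k + l)%:R.
  exists M.+1; apply: le_lt_trans qM _; rewrite ltr_nat; nia.
have [k qk kmin] := ex_minnP ex.
have kM : (k < M.+2)%N.
  rewrite ltnS; apply: kmin; apply: le_lt_trans qM _; rewrite ltr_nat; nia.
have mz i : ((N * i + l) %% N)%N = l by rewrite mulnC modnMDl modn_small.
case: (ltP ((N * k + l)%:R - q) (1/2)) => h1.
  right; exists (N * k + l)%N => //.
  by rewrite ltr_norml; apply/andP; split; lra.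
case: (ltP (q - ((N * k + l)%:R - N%:R)) (1/2)) => h2.
  (* For [k = 0] the left end is at most [-1], too far from [q >= 0]. *)
  right; case: k => [|k] in qk kmin kM h1 h2 *.
    exfalso; move: h2; rewrite muln0 add0n => h2.
    have : l.+1%:R <= N%:R :> RR by rewrite ler_nat.
    by rewrite -natr1; lra.
  exists (N * k + l)%N => //.
  have le1 : (N * k + l)%:R <= q.
    rewrite leNgt; apply/negP => /kmin; by rewrite ltnn.
  have e : (N * k.+1 + l)%:R - N%:R = (N * k + l)%:R :> RR.
    by rewrite mulnS -addnA natrD addrC addKr.
  by rewrite e in h2; rewrite ltr_norml; apply/andP; split; lra.
left; exists k => //; rewrite /bump min_l; first by rewrite max_r.
have : 1/2 <= Num.min (q - ((N * k + l)%:R - N%:R)) ((N * k + l)%:R - q).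
  by rewrite le_min h2 h1.
lra.
Qed.

End Grid.

Section Cells.
Variables (n M : nat).
Let N := n.+1.
Local Notation cells := {ffun 'I_n -> 'I_M.+3}.

(** The scaling turns tents of width [N] into tents of width [1 / (M + 1)] on the cube, so cells are
    small in every coordinate. *)
Definition cell (l : nat) (k : cells) (t : 'rV[RR]_n) : RR :=
  \prod_(j < n) bump N l (k j) ((N * M.+1)%:R * t ord0 j).

Lemma cell_cont l k : continuous (cell l k).
Proof.
move=> t; apply: (@cvg_big RR 'I_n *%R 1 xpredT _ _ (nbhs t)).
  by move=> p; apply: cvgM; [exact: cvg_fst|exact: cvg_snd].
move=> j _; apply: (bump_cont (f := fun t : 'rV[RR]_n => (N * M.+1)%:R * t ord0 j)).
by apply: rcontM; [exact: cont_cst|exact: coord_continuous].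
Qed.

Lemma cell_ge0 l k t : 0 <= cell l k t.
Proof. by apply: prodr_ge0 => j _; exact: bump_ge0. Qed.

Lemma cell_le1 l k t : cell l k t <= 1.
Proof. by apply: prodr_ile1 => j _; rewrite bump_ge0 bump_le1. Qed.

Lemma cell_neq0 l k t : cell l k t != 0 -> forall j,
  0 < bump N l (k j) ((N * M.+1)%:R * t ord0 j).
Proof.
move=> /prodf_neq0 h j; rewrite lt_def bump_ge0 andbT; exact: h.
Qed.

Lemma cell_uniq l k k' t : cell l k t != 0 -> cell l k' t != 0 -> k = k'.
Proof.
move=> /cell_neq0 h /cell_neq0 h'; apply/ffunP => j; apply/val_inj.
exact: bump_uniq (ltn0Sn n) _ _ _ _ (h j) (h' j).
Qed.

Lemma cell_close l k t t' : cell l k t != 0 -> cell l k t' != 0 ->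
  forall j, `|t ord0 j - t' ord0 j| < M.+1%:R^-1.
Proof.
move=> /cell_neq0 h /cell_neq0 h' j.
have [a1 a2] := bump_gt0 (h j); have [b1 b2] := bump_gt0 (h' j).
have M0 : 0 < M.+1%:R :> RR by rewrite ltr0n.
have N0 : 0 < N%:R :> RR by rewrite ltr0n.
rewrite -(ltr_pM2l M0) mulfV ?gt_eqF // -(ltr_pM2l N0) mulr1 mulrA -natrM.
rewrite -[X in X * _]ger0_norm ?ler0n // -normrM mulrBr ltr_norml.
by apply/andP; split; lra.
Qed.

(** Pigeonhole: if all [n + 1] colours fail, two of them fail in the same of the [n] coordinates.
    That coordinate is then within [1/2] of two integers, which must coincide, so the colours have
    equal residues. *)
Lemma cell_cover t : cube n t -> exists l k, (l <= n)%N /\ cell l k t = 1.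
Proof.
move=> ct; apply: contrapT => ne.
have bad (l : 'I_N) : exists j : 'I_n, exists2 z, (z %% N)%N = l &
    `|(N * M.+1)%:R * t ord0 j - z%:R| < 1/2.
  apply: contrapT => nj; apply: ne.
  have /choice[k kP] : forall j : 'I_n, exists k : 'I_M.+3,
      bump N l k ((N * M.+1)%:R * t ord0 j) = 1.
    move=> j; have /andP[t0 t1] := ct j.
    have [||[k kM b1]|bad] := @bump_cases N (ltn0Sn n) l M.+1
      ((N * M.+1)%:R * t ord0 j) (ltn_ord l).
    - by rewrite mulr_ge0.
    - by rewrite ler_piMr.
    - by exists (Ordinal kM).
    - by case: nj; exists j.
  exists l, [ffun j => k j]; split; first by rewrite -ltnS ltn_ord.
  by rewrite /cell big1 // => j _; rewrite ffunE kP.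
have /choice[J JP] := bad.
have : injective J.
  move=> l l' JJ; have [z zl hz] := JP l; have [z' zl' hz'] := JP l'.
  rewrite JJ in hz; apply/ord_inj; rewrite -zl -zl'; congr (_ %% _)%N.
  have H a b : (a < b)%N -> `|(N * M.+1)%:R * t ord0 (J l') - a%:R| < 1/2 ->
     `|(N * M.+1)%:R * t ord0 (J l') - b%:R| < 1/2 -> False.
    move=> ab; rewrite !ltr_norml => /andP[h1 h2] /andP[h3 h4].
    have : a.+1%:R <= b%:R :> RR by rewrite ler_nat.
    by rewrite -natr1; lra.
  by case: (ltngtP z z') => // zz; [have := H _ _ zz hz hz'|have := H _ _ zz hz' hz].
by move=> /leq_card; rewrite !card_ord ltnn.
Qed.

End Cells.

Lemma finite_max (S : nat -> Prop) (F : nat -> RR) m :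
  (exists2 i, (i < m)%N & S i) ->
  exists i, S i /\ forall j, (j < m)%N -> S j -> F j <= F i.
Proof.
elim: m => [|m IH [i im Si]]; first by case.
have [Sm|nS] := pselect (S m); last first.
  have [|i0 [Si0 mx]] := IH.
    exists i => //; move: im; rewrite ltnS leq_eqVlt => /orP[/eqP e|//].
    by rewrite e in Si.
  exists i0; split=> // j; rewrite ltnS leq_eqVlt => /orP[/eqP -> //|]; exact: mx.
have [ex|nex] := pselect (exists2 i, (i < m)%N & S i); last first.
  exists m; split=> // j; rewrite ltnS leq_eqVlt => /orP[/eqP -> //|jm Sj].
  by case: nex; exists j.
have [i0 [Si0 mx]] := IH ex; case: (leP (F i0) (F m)) => h.
  exists m; split=> // j; rewrite ltnS leq_eqVlt => /orP[/eqP -> //|jm Sj].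
  exact: le_trans (mx j jm Sj) h.
exists i0; split=> // j; rewrite ltnS leq_eqVlt => /orP[/eqP -> _|]; [exact: ltW|exact: mx].
Qed.

Section Colouring.
Variables (n : nat) (S : nat -> nat -> Prop) (sz : nat -> nat).
Hypotheses (Ssz : forall l i, S l i -> (i < sz l)%N) (S0 : forall l, exists i, S l i).

(** On each cell of colour [l] the index [i0] of a maximal weight at a sample point is selected.
    Cells of one colour are disjoint, so [b] selects at most one index at a time, and [g] varies by
    less than [e] from the sample, whence the error [2 * e]. *)
Lemma colouring (g : 'rV[RR]_n -> bfun) (e : RR) : continuous g -> 0 < e ->
  (forall t l i, 0 <= g t (l, i)) -> (forall t l i, ~ S l i -> g t (l, i) = 0) ->
  exists (b : nat -> nat -> 'rV[RR]_n -> RR) (r : nat -> 'rV[RR]_n -> RR),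
  [/\ forall l i, continuous (b l i), forall l, continuous (r l),
    forall l t, 0 <= r l t <= 1 /\
      exists2 i0, S l i0 & forall i, b l i t = r l t * (i == i0)%:R &
    forall t, cube n t -> exists l i0, [/\ (l <= n)%N, S l i0, r l t = 1,
      forall i, b l i t = (i == i0)%:R &
      forall j, g t (l, j) <= g t (l, i0) + 2 * e]].
Proof.
move=> cg e0 g0 gS; have [M MP] := cube_uniform cg e0.
have /choice[c cP] : forall lk : nat * {ffun 'I_n -> 'I_M.+3}, exists c : 'rV[RR]_n,
    forall t, cube n t -> cell lk.1 lk.2 t != 0 -> cube n c /\ cell lk.1 lk.2 c != 0.
  move=> [l k]; have [[t [ct h]]|ne] := pselect (exists t, cube n t /\ cell l k t != 0).
    by exists t.
  by exists 0 => t ct h; case: ne; exists t.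
have /choice[i0 i0P] : forall lk, exists i, S lk.1 i /\
    forall j, g (c lk) (lk.1, j) <= g (c lk) (lk.1, i).
  move=> lk; have [|i [Si mx]] := @finite_max (S lk.1) (fun j => g (c lk) (lk.1, j)) (sz lk.1).
    by have [i Si] := S0 lk.1; exists i => //; exact: Ssz.
  exists i; split=> // j; have [Sj|nS] := pselect (S lk.1 j); last by rewrite gS.
  by apply: mx => //; exact: Ssz.
pose b l i t := \sum_(k : {ffun 'I_n -> 'I_M.+3}) cell l k t * (i == i0 (l, k))%:R.
pose r l t := \sum_(k : {ffun 'I_n -> 'I_M.+3}) cell l k t.
have one l k t : cell l k t != 0 -> r l t = cell l k t /\
    forall i, b l i t = cell l k t * (i == i0 (l, k))%:R.
  move=> ck; have z k' : k' != k -> cell l k' t = 0.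
    by move=> kk; apply: contrapT => /eqP ck'; case/eqP: kk; exact: cell_uniq ck' ck.
  split=> [|i]; rewrite /r /b (bigD1 k) //=.
    by rewrite big1 ?addr0 // => k' kk; exact: z.
  by rewrite big1 ?addr0 // => k' kk; rewrite z // mul0r.
exists b, r; split.
- move=> l i; apply: rcont_sum => k; apply: rcontM; [exact: cell_cont|exact: cont_cst].
- move=> l; apply: rcont_sum => k; exact: cell_cont.
- move=> l t; have [[k ck]|nk] := pselect (exists k : {ffun 'I_n -> 'I_M.+3}, cell l k t != 0).
    have [rE bE] := one l k t ck; rewrite rE cell_ge0 cell_le1; split=> //.
    by exists (i0 (l, k)) => [|i]; [have [] := i0P (l, k)|exact: bE].
  have z (k : {ffun 'I_n -> 'I_M.+3}) : cell l k t = 0 by apply: contrapT => /eqP ck; apply: nk; exists k.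
  have rE : r l t = 0 by rewrite /r big1.
  rewrite rE lexx ler01; split=> //; have [i Si] := S0 l; exists i => // j.
  by rewrite mul0r /b big1 // => k _; rewrite z mul0r.
- move=> t ct; have [l [k [ln ck]]] := @cell_cover n M t ct.
  have ck0 : cell l k t != 0 by rewrite ck oner_neq0.
  have [rE bE] := one l k t ck0; have [Si mx] := i0P (l, k).
  exists l, (i0 (l, k)); split=> //; first by rewrite rE.
    by move=> i; rewrite bE ck mul1r.
  move=> j; have [cc cc0] := cP (l, k) t ct ck0.
  have := MP t (c (l, k)) ct (cell_close ck0 cc0) => gc.
  have H i : `|g t (l, i) - g (c (l, k)) (l, i)| < e.
    exact: le_lt_trans (bfun_norm_ge (g t - g (c (l, k))) (l, i)) gc.
  have := H j; have := H (i0 (l, k)); rewrite !ltr_norml => /andP[h1 h2] /andP[h3 h4].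
  by have := mx j; rewrite /=; lra.
Qed.

End Colouring.

(** * From selections to disjoint refinements *)

Section Converse.
Variables (X : topologicalType) (w : nat -> seq (set X)).
Hypothesis wc : forall l, fo_cover (w l).

Let U l i := nth set0 (w l) i.
(** Decaying bounds make the levels beyond [m] uniformly small, which lower semi-continuity in the
    sup norm requires. *)
Let wt l : RR := 2^-1 ^+ l.

Lemma In_nth (A : Type) (d : A) (s : seq A) a :
  List.In a s <-> exists2 i, (i < size s)%N & nth d s i = a.
Proof.
elim: s => [|b s IH] /=; first by split=> [|[]].
rewrite IH; split=> [[->|[i si <-]]|[[|i] si <-]].
- by exists 0%N.
- by exists i.+1.
- by left.
- by right; exists i.
Qed.

Let wt0 l : 0 < wt l.
Proof. by rewrite exprn_gt0 // invr_gt0. Qed.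

Let wt1 l : wt l <= 1.
Proof. by apply: exprn_ile1; lra. Qed.

Let wtS l m : (l <= m)%N -> wt m <= wt l.
Proof. by move=> lm; apply: ler_wiXn2l => //; lra. Qed.

Let U_size l i x : U l i x -> (i < size (w l))%N.
Proof. by move=> Ux; rewrite ltnNge; apply/negP => h; move: Ux; rewrite /U nth_default. Qed.

Let U_open l i : open (U l i).
Proof.
case: (ltnP i (size (w l))) => h; last by rewrite /U nth_default //; exact: open0.
have [+ _] := wc l => /(_ (U l i))[|f [cf ->]]; last exact: open_neq0.
by apply/(In_nth set0); exists i.
Qed.

Let U_cover l x : exists i, U l i x.
Proof.
have [_ /(_ x)[V /(In_nth set0)[i _ Vi] Vx]] := wc l.
by exists i; rewrite /U Vi.
Qed.

Definition cover_weights (x : X) : set bfun :=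
  [set y | forall l i, 0 <= y (l, i) <= wt l /\ (~ U l i x -> y (l, i) = 0)].

(** The comparison ranges over the finite cover [w l], which makes dominance an open condition. *)
Definition dominant (y : bfun) l i : Prop :=
  0 < y (l, i) /\ forall j, (j < size (w l))%N -> j != i -> y (l, j) < y (l, i).

Definition no_dominant m : set bfun := [set y | forall l i, (l <= m)%N -> ~ dominant y l i].

Lemma dominant_open l i : open [set y | dominant y l i].
Proof.
rewrite openE => y [y0 yj].
have nj : nbhs y [set y' : bfun | forall j, (`I_(size (w l)) `&` [set j | j != i]) j ->
    y' (l, j) < y' (l, i)].
  apply: (near_finite (A := fun j => [set y' : bfun | y' (l, j) < y' (l, i)])).
    by apply: sub_finite_set (finite_II (size (w l))) => j [].
  move=> j [jl ji]; apply: open_nbhs_nbhs; split; last exact: yj.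
  by apply: open_ltfun; exact: bcoord_cont.
have n0 : nbhs y [set y' : bfun | (0 : RR) < y' (l, i)].
  apply: open_nbhs_nbhs; split=> //.
  by apply: open_ltfun; [exact: cont_cst|exact: bcoord_cont].
by apply: filterS2 n0 nj => y' h1 h2; split=> // j jl ji; exact: h2.
Qed.

Lemma no_dominant_closed m : closed (no_dominant m).
Proof.
rewrite (_ : no_dominant m = ~` \bigcup_(l in [set l | (l <= m)%N]) \bigcup_i [set y | dominant y l i]).
  by apply: open_closedC; do 2 apply: bigcup_open => ? _; exact: dominant_open.
apply/seteqP; split=> y h; first by move=> [l lm [i _ d]]; exact: h lm d.
by move=> l i lm d; apply: h; exists l => //; exists i.
Qed.

Lemma no_dominant0 m : no_dominant m 0.
Proof. by move=> l i _ [h _]; rewrite [X in 0 < X](_ : _ = 0) ?ltxx in h. Qed.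

Lemma cover_weights0 x : cover_weights x 0.
Proof. by move=> l i; split=> //; rewrite [X in 0 <= X <= _](_ : _ = 0) // lexx ltW. Qed.

Lemma cover_weights_ccn x : closed_convex_nonempty (cover_weights x).
Proof.
split; last split.
- rewrite (_ : cover_weights x = \bigcap_(k in [set: nat * nat])
    ([set y : bfun | (0 : RR) <= y k] `&` [set y : bfun | (y k : RR) <= wt k.1] `&`
     [set y : bfun | ~ U k.1 k.2 x -> (y k : RR) <= 0])).
    apply: closed_bigI => k _; apply: closedI; first apply: closedI.
    + by apply: closed_lefun; [exact: cont_cst|exact: bcoord_cont].
    + by apply: closed_lefun; [exact: bcoord_cont|exact: cont_cst].
    + have [Ux|nU] := pselect (U k.1 k.2 x).
        by rewrite (_ : [set y | _] = setT); [exact: closedT|apply/seteqP; split=> // y _ nU; case: (nU Ux)].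
      rewrite (_ : [set y | _] = [set y : bfun | (y k : RR) <= 0]).
        by apply: closed_lefun; [exact: bcoord_cont|exact: cont_cst].
      by apply/seteqP; split=> y /=; [apply|].
  apply/seteqP; split=> y h.
    move=> [l i] _; have [/andP[h0 h1] h2] := h l i; split; first by split.
    by move=> nU /=; rewrite h2.
  move=> l i; have [[h0 h1] h2] := h (l, i) I; split; first by apply/andP.
  by move=> /h2 /= h3; apply/eqP; rewrite eq_le h3 h0.
- by exists 0; exact: cover_weights0.
- move=> a b ha hb t t0 t1 l i.
  have [/andP[a0 a1] a2] := ha l i; have [/andP[b0 b1] b2] := hb l i.
  have -> : (t *: a + (1 - t) *: b) (l, i) = t * a (l, i) + (1 - t) * b (l, i) by [].
  split; last by move=> nU; rewrite a2 // b2 // !mulr0 addr0.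
  by apply/andP; split; nra.
Qed.

Lemma bfun_of (f : nat * nat -> RR^o) (M : RR) : (forall k, `|f k| <= M) ->
  exists y : bfun, forall k, y k = f k.
Proof.
move=> fM; have fb : f \in bounded_fun_pred by apply/asboolP; exists M.
by exists (BFun fb).
Qed.

(** Truncating [y] above a level [m] with [wt m < e] costs less than [e], and the truncation
    involves finitely many open sets [U l i], so it remains admissible near [x]. *)
Lemma cover_weights_lsc : lsc_setmap cover_weights.
Proof.
move=> O oO; rewrite openE => x [y [yx Oy]].
have /nbhs_ballP[e /= e0 eO] : nbhs y O by exact: open_nbhs_nbhs.
have [m hm] : exists m, wt m < e.
  have hl : wt n @[n --> \oo] --> (0 : RR).
    by apply: cvg_expr; rewrite ger0_norm ?invr_ge0 // invf_lt1 // ltr1n.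
  have /(@cvgrPdist_lt _ RR^o) /(_ e e0) [m _ mP] := hl.
  by exists m; have := mP m (leqnn m); rewrite /= sub0r normrN gtr0_norm.
have [|z zE] := @bfun_of (fun k => if (k.1 < m)%N then y k else 0) `|y|.
  by move=> k; case: ifP => _; [exact: bfun_norm_ge|rewrite normr0].
have nx : nbhs x [set x' | forall l, `I_m l -> forall i, `I_(size (w l)) i ->
    U l i x -> U l i x'].
  apply: near_finite => [|l lm]; first exact: finite_II.
  apply: (near_finite (A := fun i => [set x' | U l i x -> U l i x'])) => [|i il].
    exact: finite_II.
  have [Ux|nU] := pselect (U l i x); last by apply: nearW => x' /nU.
  by apply: filterS (open_nbhs_nbhs (conj (U_open l i) Ux)) => x' Ux' _.
apply: filterS nx => x' hx'; exists z; split.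
  move=> l i; rewrite zE /=; have [yb yU] := yx l i.
  case: (ltnP l m) => lm; last by rewrite lexx ltW.
  split=> // nU; apply: yU => Ux; apply: nU; apply: hx' => //; exact: U_size Ux.
apply: eO; rewrite -ball_normE /=; apply: le_lt_trans hm.
apply: bfun_norm_le => -[l i]; rewrite [(y - z) _](_ : _ = y (l, i) - z (l, i)) // zE /=.
case: (ltnP l m) => lm; first by rewrite subrr normr0 ltW.
have [/andP[y0 y1] _] := yx l i.
by rewrite subr0 ger0_norm //; apply: le_trans y1 (wtS lm).
Qed.

Lemma bfun_sum (I : Type) (r : seq I) (F : I -> bfun) k :
  (\sum_(i <- r) F i) k = \sum_(i <- r) F i k.
Proof. by elim: r => [|i r IH]; rewrite ?big_nil // !big_cons -IH. Qed.

Lemma sum_pick m l (F : nat -> RR) :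
  \sum_(i < m) (if l == i :> nat then F i else 0) = if (l < m)%N then F l else 0.
Proof.
elim: m => [|m IH]; first by rewrite big_ord0.
rewrite big_ord_recr /= IH [(l < m.+1)%N]ltnS [(l <= m)%N]leq_eqVlt; case: (eqVneq l m) => [->|lm] /=.
  by rewrite ltnn add0r.
by rewrite addr0.
Qed.

Lemma shrink_toward (p a c : RR) : 0 <= p -> p <= 1 -> 0 <= a -> a <= c ->
  0 <= (1 - p) * a <= c /\ 0 <= (1 - p) * a + p * c <= c.
Proof. by move=> p0 p1 a0 ac; split; apply/andP; split; nra. Qed.

(** Turns a basic neighbourhood of the compact-open topology into a uniform tolerance. *)
Lemma uniform_margin (Y : completeNormedModType RR) (T : topologicalType)
    (g : T -> Y) (s : seq (set T * set Y)) : continuous g ->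
  (forall p, List.In p s -> [/\ compact p.1, open p.2 & g @` p.1 `<=` p.2]) ->
  exists2 e : RR, 0 < e & forall p t z, List.In p s -> p.1 t -> `|g t - z| < e -> p.2 z.
Proof.
move=> cg; elim: s => [|p s IH] sP; first by exists 1.
have [|e e0 eP] := IH; first by move=> q qs; apply: sP; right.
have [cK oV gV] := sP p (or_introl erefl).
have [|d d0 dP] := compact_avoid cK cg (open_closedC oV).
  by move=> t pt; apply; apply: gV; exists t.
exists (Num.min d e); first by rewrite lt_min d0.
move=> q t z [<-|qs] qt; rewrite lt_min => /andP[h1 h2]; last exact: eP qs qt h2.
by apply: contrapT; exact: dP qt h1.
Qed.

(** On each level [l <= n] the weights are moved by the fraction [d * r l t] towards the full weight
    [wt l] at the index selected by the colouring. At every point of the cube some level has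
    [r l t = 1], and there the selected index, already almost maximal, becomes dominant. *)
Lemma no_dominant_Z x n : Zn_set_in n (cover_weights x) (cover_weights x `&` no_dominant n).
Proof.
split; first by move=> y [].
split; first by exists (no_dominant n) => //; exact: no_dominant_closed.
move=> g0 [cg0 g0x] s sP.
pose g t := g0 (clamp t).
have cg : continuous g by exact: clamp_comp_cont.
have gx t : cover_weights x (g t) by apply: g0x; exists (clamp t) => //; exact: clamp_cube.
have gE t : cube n t -> g t = g0 t by move=> ct; rewrite /g clamp_id.
have [|e e0 eP] := @uniform_margin bfun _ g s cg.
  move=> p ps; have [cK sK oV gV] := sP p ps; split=> // _ [t pt <-].
  by rewrite gE; [apply: gV; exists t|exact: sK].
(* [d < e] respects the given neighbourhood, and [d <= 1/2] keeps the coefficients [1 - d * r l t]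
   positive. *)
pose d := Num.min (1/2) (e / 2).
have d0 : 0 < d by rewrite lt_min !divr_gt0.
have d1 : d <= 1/2 by rewrite ge_min lexx.
have de : d < e by apply: (@le_lt_trans _ _ (e / 2)); [rewrite ge_min lexx orbT|lra].
(* Twice this colouring error is [d * wt n / 2], less than the gain [d * wt l] on every level
   [l <= n]. *)
have eta0 : 0 < d * wt n / 4 by rewrite divr_gt0 // mulr_gt0.
have [||b [r [cb cr br dom]]] := @colouring n (fun l i => U l i x) (fun l => size (w l))
  (fun l i => @U_size l i x) (fun l => U_cover l x) g _ cg eta0.
- by move=> t l i; have [/andP[]] := gx t l i.
- by move=> t l i; have [_] := gx t l i.
have /choice[proj projE] : forall ly : nat * bfun, exists z : bfun,
    forall k, z k = if k.1 == ly.1 then ly.2 k else 0.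
  move=> [l y]; apply: (@bfun_of _ `|y|) => k /=.
  by case: ifP => _; [exact: bfun_norm_ge|rewrite normr0].
have /choice[unit unitE] : forall k0 : nat * nat, exists z : bfun,
    forall k, z k = (k == k0)%:R.
  by move=> k0; apply: (@bfun_of _ 1) => k; case: eqP => _; rewrite ?normr1 ?normr0.
have cproj l : continuous (fun y => proj (l, y)).
  move=> y; apply/(@cvgrPdist_lt RR bfun bfun (nbhs y) (nbhs_filter y)) => c c0.
  have /cvgrPdist_lt /(_ c c0) := @cvg_id _ (nbhs y).
  apply: filterS => y'; apply: le_lt_trans; apply: bfun_norm_le => k.
  change (`|proj (l, y) k - proj (l, y') k| <= `|y - y'|); rewrite !projE /=.
  by case: ifP => _; [exact: (bfun_norm_ge (y - y'))|rewrite subrr normr0].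
(* Written as a finite sum of vectors of [bfun], because coordinatewise continuity would not give
   continuity in the sup norm. *)
pose h t := g t + (\sum_(l < n.+1) (- d * r l t) *: proj (nat_of_ord l, g t) +
  \sum_(l < n.+1) \sum_(i < size (w l)) (d * b l i t * wt l) *: unit (nat_of_ord l, nat_of_ord i)).
have ch : continuous h.
  apply: contD => //; apply: contD; apply: cont_sum => l.
    apply: contZ; first by apply: comp_cont (cproj l).
    by apply: rcontM => //; exact: cont_cst.
  apply: cont_sum => i; apply: contZ; first exact: cont_cst.
  by apply: rcontM; [apply: rcontM => //|]; exact: cont_cst.
have hE t l j : h t (l, j) = if (l < n.+1)%N
    then (1 - d * r l t) * g t (l, j) + d * b l j t * wt l else g t (l, j).
  (* Positions beyond the cover carry no weight, so the finite sum over [w l] is correct for every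
     [j]. *)
  have bsz : b l j t = if (j < size (w l))%N then b l j t else 0.
    case: ltnP => // jl; have [_ [i0 Ui ->]] := br l t.
    by case: eqP => [ji|]; rewrite ?mulr0 //; move: (U_size Ui); rewrite -ji ltnNge jl.
  have -> : h t (l, j) = g t (l, j) +
      ((\sum_(l < n.+1) (- d * r l t) *: proj (nat_of_ord l, g t)) (l, j) +
      (\sum_(l < n.+1) \sum_(i < size (w l)) (d * b l i t * wt l) *:
        unit (nat_of_ord l, nat_of_ord i)) (l, j)) by [].
  rewrite !bfun_sum.
  rewrite (eq_bigr (fun l' : 'I_n.+1 => if l == l' :> nat then - d * r l t * g t (l, j) else 0)); last first.
    move=> l' _; rewrite [LHS](_ : _ = - d * r l' t * proj (nat_of_ord l', g t) (l, j)) //.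
    by rewrite projE /=; case: eqP => [->//|_]; rewrite mulr0.
  rewrite (sum_pick _ _ (fun _ => - d * r l t * g t (l, j))).
  rewrite (eq_bigr (fun l' : 'I_n.+1 => if l == l' :> nat then d * b l j t * wt l else 0)); last first.
    move=> l' _; rewrite bfun_sum.
    rewrite (eq_bigr (fun i : 'I_(size (w l')) => if j == i :> nat
       then (if l == l' :> nat then d * b l' j t * wt l' else 0) else 0)); last first.
      move=> i _; rewrite [LHS](_ : _ = d * b l' i t * wt l' * unit (nat_of_ord l', nat_of_ord i) (l, j)) //.
      rewrite unitE xpair_eqE.
      case: (eqVneq j i) => [->|_]; last by rewrite andbF mulr0.
      by rewrite andbT; case: eqP => _; rewrite ?mulr1 ?mulr0.
    rewrite (sum_pick _ _ (fun _ => if l == l' :> nat then d * b l' j t * wt l' else 0)).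
    case: eqP => [e1|_]; last by case: ifP.
    by rewrite -e1; case: ltnP => // jl; rewrite bsz ltnNge jl /= mulr0 mul0r.
  rewrite (sum_pick _ _ (fun _ => d * b l j t * wt l)).
  by case: ifP => _; [ring|rewrite !addr0].
have hx t : cover_weights x (h t).
  move=> l j; rewrite hE; have [/andP[gt0 gt1] gtU] := gx t l j.
  case: ifP => _; last by split=> //; apply/andP.
  have [/andP[r0 r1] [i0 Ui bE]] := br l t; rewrite bE.
  have p0 : 0 <= d * r l t by rewrite mulr_ge0 // ltW.
  have p1 : d * r l t <= 1 by nra.
  case: eqP => [->|ji].
    rewrite mulr1; split=> [|//].
    have [/andP[a0 a1] _] := gx t l i0; exact: (shrink_toward p0 p1 a0 a1).2.
  rewrite !mulr0 mul0r addr0; split; last by move=> /gtU ->; rewrite mulr0.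
  exact: (shrink_toward p0 p1 gt0 gt1).1.
have hd t : `|h t - g t| <= d.
  apply: bfun_norm_le => -[l j].
  rewrite [(h t - g t) _](_ : _ = h t (l, j) - g t (l, j)) // hE.
  case: ifP => _; last by rewrite subrr normr0 ltW.
  have [/andP[gt0 gt1] _] := gx t l j; have [/andP[r0 r1] [i0 Ui bE]] := br l t.
  have b0 : 0 <= b l j t <= 1.
    by rewrite bE; case: eqP => _; rewrite ?mulr1 ?mulr0 ?lexx ?ler01 // r0.
  have g1 : g t (l, j) <= 1 by exact: le_trans (wt1 l).
  have wl := wt0 l; have wl1 := wt1 l; case/andP: b0 => b0 b1.
  have m1 : 0 <= b l j t * wt l <= 1 by apply/andP; split; nra.
  have m2 : 0 <= r l t * g t (l, j) <= 1 by apply/andP; split; nra.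
  case/andP: m1 => m10 m11; case/andP: m2 => m20 m21.
  have -> : (1 - d * r l t) * g t (l, j) + d * b l j t * wt l - g t (l, j) =
     d * (b l j t * wt l - r l t * g t (l, j)) by ring.
  rewrite normrM gtr0_norm // -[leRHS]mulr1; apply: ler_wpM2l; first exact: ltW.
  by rewrite ler_norml; apply/andP; split; lra.
exists h; split; first split.
- exact: continuous_subspaceT.
- move=> _ [t ct <-]; split=> // -[_ nd].
  have [l [i0 [ln Ui rl bE gl]]] := dom t ct; apply: (nd l i0 ln).
  have wl := wt0 l; have wln := wtS ln; have wn := wt0 n.
  have hi : h t (l, i0) = (1 - d) * g t (l, i0) + d * wt l.
    by rewrite hE ltnS ln rl bE eqxx !mulr1.
  have [/andP[gi0 _] _] := gx t l i0.
  split=> [|j jl ji]; first by rewrite hi; nra.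
  rewrite hi hE ltnS ln rl bE (negbTE ji) !mulr1 !mulr0 mul0r addr0.
  have gj := gl j; have q1 : d * wt n <= d * wt l by apply: ler_wpM2l => //; exact: ltW.
  have q0 : 0 < d * wt l by rewrite mulr_gt0.
  move: q1 q0 gj; set a := d * wt l; set a' := d * wt n => q1 q0 gj.
  have a'0 : 0 < a' by rewrite mulr_gt0.
  have : (1 - d) * g t (l, j) <= (1 - d) * (g t (l, i0) + 2 * (a' / 4)).
    by apply: ler_wpM2l => //; lra.
  nra.
- move=> p ps _ [t pt <-]; apply: (eP p t) => //; rewrite distrC.
  exact: le_lt_trans (hd t) de.
Qed.

(** Dominance at a given level is unique within the cover, and a dominant weight is positive, so the
    sets [D l i] are disjoint and refine [w l]; avoiding [no_dominant m] says that the levels up to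
    [m] cover. *)
Lemma dominant_disjoint_families m (f : X -> bfun) : continuous f ->
  (forall x, (cover_weights x `\` no_dominant m) (f x)) ->
  exists (k : nat) (g : nat -> seq (set X)),
    (forall n, (n < k)%N -> [/\ forall V, List.In V (g n) -> functionally_open V,
       fam_disjoint (g n) & fam_refines (g n) (w n)]) /\
    (forall x : X, exists n, (n < k)%N /\ exists2 V, List.In V (g n) & V x).
Proof.
move=> cf fx.
pose D l i := [set x | dominant (f x) l i].
have DU l i : D l i `<=` U l i.
  move=> x [h _]; apply: contrapT => nU; have [fw _] := fx x.
  by have [_ /(_ nU) h0] := fw l i; rewrite h0 ltxx in h.
exists m.+1, (fun l => [seq D l i | i <- iota 0 (size (w l))]); split.
  move=> l _; split.
  - move=> _ /In_map[i _ <-].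
    (* A product of positive parts is nonzero exactly when all the defining strict inequalities
       hold. *)
    pose v x := Num.max 0 (f x (l, i) : RR) * \prod_(j < size (w l) | j != i :> nat)
      Num.max 0 ((f x (l, i) : RR) - f x (l, nat_of_ord j)).
    have cc j : continuous (fun x => (f x j : RR)) by apply: comp_cont cf (@bcoord_cont j).
    exists v; split.
      apply: rcontM; first by apply: rcont_max => //; exact: cont_cst.
      move=> x; apply: (@cvg_big RR _ *%R 1 _ _ _ (nbhs x)).
        by move=> p; apply: cvgM; [exact: cvg_fst|exact: cvg_snd].
      move=> j _.
      apply: (rcont_max (f := fun=> 0) (g := fun x => (f x (l, i) : RR) - f x (l, nat_of_ord j))).
        exact: cont_cst.
      exact: rcontB.
    have mx (z : RR) : (Num.max 0 z != 0) = (0 < z).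
      apply/idP/idP => h; last by rewrite gt_eqF // lt_max h orbT.
      have : 0 < Num.max 0 z by rewrite lt_def h le_max lexx.
      by rewrite lt_max ltxx.
    apply/seteqP; split=> x /=.
      move=> [h0 hj]; rewrite /v mulf_neq0 ?mx //.
      by apply/prodf_neq0 => j ji; rewrite mx subr_gt0; exact: hj.
    rewrite /v mulf_eq0 negb_or mx => /andP[h0 /prodf_neq0 hj]; split=> // j jl ji.
    by have := hj (Ordinal jl) ji; rewrite mx subr_gt0.
  - move=> _ _ /In_map[i /In_mem iw <-] /In_map[j /In_mem jw <-] ne.
    apply/seteqP; split=> // x [[_ hi] [_ hj]]; apply: ne; congr (D l _).
    apply: contrapT => /eqP ij; rewrite !mem_iota !add0n /= in iw jw.
    have := hj i iw ij; have := hi j jw; rewrite eq_sym => /(_ ij) h1 h2.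
    by have := lt_trans h1 h2; rewrite ltxx.
  - move=> _ /In_map[i /In_mem iw <-]; exists (U l i); last exact: DU.
    by apply/(In_nth set0); exists i => //; rewrite mem_iota in iw.
move=> x; have [fw nd] := fx x.
have [[l [i [lm d]]]|ne] := pselect (exists l i, (l <= m)%N /\ dominant (f x) l i); last first.
  by case: nd => l i lm d; apply: ne; exists l, i.
exists l; split=> //; exists (D l i) => //; apply/In_map; exists i => //.
by apply/In_mem; rewrite mem_iota add0n /=; apply: U_size; exact: DU d.
Qed.

End Converse.

(** The selection property is assumed only for [bfun] and nonempty closed sets [F n], so that both
    selection statements of the theorem imply it. *)
Lemma finite_C_of_selections (X : topologicalType) :
  (forall (phi : X -> set bfun) (F : nat -> set bfun),
    (forall x, closed_convex_nonempty (phi x)) -> lsc_setmap phi ->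
    (forall n, closed_nonempty (F n)) -> (forall n, F n.+1 `<=` F n) ->
    zseq_for phi (fun n _ => F n) ->
    exists (m : nat) (f : X -> bfun), continuous f /\ forall x, (phi x `\` F m) (f x)) ->
  finite_C_space X.
Proof.
move=> sel w wc.
have [|||||m [f [cf fx]]] := sel (cover_weights w) (no_dominant w).
- exact: cover_weights_ccn.
- exact: cover_weights_lsc.
- by move=> n; split; [exact: no_dominant_closed|exists 0; exact: no_dominant0].
- by move=> n y h l i ln; apply: h; exact: leqW.
- by move=> x n; exact: no_dominant_Z.
exact: dominant_disjoint_families cf fx.
Qed.

Lemma closed_graph_cst (X Y : topologicalType) (F : set Y) :
  closed F -> closed_graph (fun _ : X => F).
Proof.
move=> cF; rewrite /closed_graph (_ : [set p | _] = ~` ((fun p : X * Y => p.2) @^-1` (~` F))).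
  apply: open_closedC; apply: open_comp; last exact: closed_openC.
  by move=> p _; exact: snd_cont.
by apply/seteqP; split=> p /=; [move=> h; apply|move/contrapT].
Qed.

Theorem theorem1p2 (X : topologicalType) (hX : paracompact X) :
  (finite_C_space X <->
   (forall (Y : completeNormedModType RR) (phi : X -> set Y)
           (psi : nat -> X -> set Y),
      (forall x, closed_convex_nonempty (phi x)) ->
      lsc_setmap phi ->
      (forall n x, closed_nonempty (psi n x)) ->
      (forall n, closed_graph (psi n)) ->
      decreasing_family psi -> zseq_for phi psi ->
      exists (m : nat) (f : X -> Y), continuous f /\
        forall x, (phi x `\` psi m x) (f x))) /\
  (finite_C_space X <->
   (forall (Y : completeNormedModType RR) (phi : X -> set Y)
           (F : nat -> set Y),
      (forall x, closed_convex_nonempty (phi x)) ->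
      lsc_setmap phi ->
      (forall n, closed (F n)) ->
      (forall n, F n.+1 `<=` F n) ->
      zseq_for phi (fun n _ => F n) ->
      exists (m : nat) (f : X -> Y), continuous f /\
        forall x, (phi x `\` F m) (f x))).
Proof.
split; split.
- move=> hC Y phi psi phic phil _ psic psid psiZ.
  exact (@avoiding_selection X hX Y phi phic phil psi psic psid psiZ hC).
- move=> sel; apply: finite_C_of_selections => phi F phic phil Fc Fd FZ.
  (* A nonempty closed set is turned into a constant map with closed graph. *)
  apply: (sel bfun phi (fun n _ => F n)) => // n.
  by apply: closed_graph_cst; have [] := Fc n.
- move=> hC Y phi F phic phil Fc Fd FZ.
  apply: (avoiding_selection hX phic phil _ _ FZ hC) => [n|x n]; last exact: Fd.
  exact: closed_graph_cst.
- move=> sel; apply: finite_C_of_selections => phi F phic phil Fc Fd FZ.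
  by apply: sel => // n; have [] := Fc n.
Qed.
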